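(* Let $W(z)$ be a function analytic and without zeros in the upper half-plane $\Im z>0$. Let $T$ be a linear transformation of $\mathcal F(W)$ into itself which maps $K(w,\cdot)$ to $K(w+i,\cdot)$ for every complex $w$ with $\Im w>0$. Assume that $$\Re\langle F, TF\rangle_{\mathcal F(W)}\geqslant 0$$ for all $F\in\mathcal F(W)$. Then $W$ has an analytic extension to the half-plane $\Im z>-1/2$, and $W(z)/W(z+i)$ has nonnegative real part throughout the half-plane $\Im z>-1/2$.
   Context: For $W$ analytic and zero-free in the upper half-plane, $\mathcal F(W)$ is the set of all functions $F$ analytic in the upper half-plane such that $F/W$ can be written as a quotient of bounded analytic functions in the upper half-plane, $F/W$ has square integrable boundary values on the real axis, and $$\log|F(x+iy)/W(x+iy)|\leqslant \frac{y}{\pi}\int_{-\infty}^{\infty}\frac{\log|F(t)/W(t)|}{(t-x)^2+y^2}\,dt\quad\text{for all real }x\text{ and }y>0$$ (here $F(t),W(t)$ denote boundary values). Its inner product is $\langle F,G\rangle_{\mathcal F(W)}=\int_{-\infty}^{\infty}F(x)\overline{G(x)}\,|W(x)|^{-2}\,dx$. For $\Im w>0$ and $\Im z>0$ set $$K(w,z)=\frac{W(z)\overline{W(w)}}{2\pi i(\bar w-z)},$$ which is the reproducing kernel of $\mathcal F(W)$: $F(w)=\langle F,K(w,\cdot)\rangle_{\mathcal F(W)}$ for all $F\in\mathcal F(W)$ and $\Im w>0$. *)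

(* Defs.v *)
From mathcomp Require Import all_boot all_order all_algebra.
From mathcomp Require Import all_classical all_reals all_analysis.
From mathcomp Require Export complex.

Set Implicit Arguments.
Unset Strict Implicit.
Unset Printing Implicit Defensive.

Import Order.TTheory GRing.Theory Num.Theory.
Import numFieldNormedType.Exports.

Local Open Scope classical_set_scope.
Local Open Scope ring_scope.
Local Open Scope complex_scope.

Local Notation normc := ComplexField.Normc.normc.

Section Definitions.
Variable R : realType.

(* The topology on R[i] is the one of the normed field R[i], and the derivative
   is taken over the scalars R[i], so [derivable _ z 1] is complex
   differentiability at [z]. *)
Definition holomorphic_on (A : set R[i]) (f : R[i] -> R[i]) : Prop :=
  forall z, A z -> derivable (f : R[i]^o -> R[i]^o) z 1.

Definition half_plane (a : R) : set R[i] := [set z | a < complex.Im z].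

Definition upper_half_plane : set R[i] := half_plane 0.

Definition bounded_holomorphic (p : R[i] -> R[i]) : Prop :=
  holomorphic_on upper_half_plane p /\
  exists M : R, forall z, upper_half_plane z -> normc (p z) <= M.

(* [f = p / q] in the upper half-plane, where [q] is not identically zero; at a
   zero of [q] the quotient is understood after cancellation. *)
Definition bounded_type (f : R[i] -> R[i]) : Prop :=
  exists p q : R[i] -> R[i],
    [/\ bounded_holomorphic p, bounded_holomorphic q,
        exists2 z, upper_half_plane z & q z != 0
      & forall z, upper_half_plane z -> f z * q z = p z].

Definition has_boundary_value (f : R[i] -> R[i]) (x : R) : Prop :=
  cvg ((fun y : R => f (x +i* y) : R[i]^o) @ 0^'+).

Definition boundary_value (f : R[i] -> R[i]) (x : R) : R[i] :=
  lim ((fun y : R => f (x +i* y) : R[i]^o) @ 0^'+).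

Definition square_integrable_boundary_values (f : R[i] -> R[i]) : Prop :=
  {ae (@lebesgue_measure R), forall x, has_boundary_value f x} /\
  (@lebesgue_measure R).-integrable setT
    (fun x => (normc (boundary_value f x) ^+ 2)%:E).

(* The logarithms are extended-valued, with log 0 = -oo: [f] may have zeros, and
   for [f = 0] both sides are -oo. The positive part of the integrand is
   integrable as soon as the boundary values are square integrable. *)
Definition log_poisson_bound (f : R[i] -> R[i]) : Prop :=
  forall x y : R, 0 < y ->
    (lne (normc (f (x +i* y)))%:E <=
     (y / pi)%:E *
     \int[@lebesgue_measure R]_t
       (lne (normc (boundary_value f t))%:E *
        (((t - x) ^+ 2 + y ^+ 2)^-1)%:E))%E.

(* A function on the upper half-plane is represented by its extension by 0 to
   R[i], so that equality of elements of [FW W] is equality on the upper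
   half-plane. *)
Definition FW (W : R[i] -> R[i]) : set (R[i] -> R[i]) :=
  [set F | [/\ forall z, ~ upper_half_plane z -> F z = 0,
               holomorphic_on upper_half_plane F,
               bounded_type (fun z => F z / W z),
               square_integrable_boundary_values (fun z => F z / W z)
             & log_poisson_bound (fun z => F z / W z)]].

Definition complex_integral (g : R -> R[i]) : R[i] :=
  Rintegral (@lebesgue_measure R) setT (fun x => complex.Re (g x)) +i*
  Rintegral (@lebesgue_measure R) setT (fun x => complex.Im (g x)).

(* F conj(G) |W|^-2 = (F/W) conj(G/W): only the quotients F/W and G/W are
   guaranteed to have boundary values. *)
Definition FW_inner (W F G : R[i] -> R[i]) : R[i] :=
  complex_integral (fun x =>
    boundary_value (fun z => F z / W z) x *
    conjc (boundary_value (fun z => G z / W z) x)).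

Definition FW_kernel (W : R[i] -> R[i]) (w z : R[i]) : R[i] :=
  if 0 < complex.Im z then
    W z * conjc (W w) / (2%:R * (pi : R)%:C * 'i%C * (conjc w - z))
  else 0.

Definition FW_linear_transformation (W : R[i] -> R[i])
    (T : (R[i] -> R[i]) -> (R[i] -> R[i])) : Prop :=
  (forall F, FW W F -> FW W (T F)) /\
  (forall (a b : R[i]) F G, FW W F -> FW W G ->
     T (fun z => a * F z + b * G z) = (fun z => a * T F z + b * T G z)).

End Definitions.

(* Main.v *)
Require Import Defs.
From mathcomp Require Import all_boot all_order all_algebra.
From mathcomp Require Import ring lra.
From mathcomp Require Import all_classical all_reals all_analysis.
From mathcomp Require Import measurable_realfun.
Set Implicit Arguments.
Unset Strict Implicit.
Unset Printing Implicit Defensive.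
Import Order.TTheory GRing.Theory Num.Theory.
Import numFieldNormedType.Exports.
Local Open Scope ring_scope.

(** Testing accretivity on finite sums of the kernels [K(w, .)] shows that, with
    [phi z = W z / W (z + i)] and [z' = z + i/2], the kernel
    [(phi z + conj (phi w)) * i / (z' - conj w')] is positive semidefinite on
    [Im z' > 1/2], which by a Cayley transform becomes a Pick kernel
    [(1 - f z conj (f w)) * i / (z - conj w)]. Schur's algorithm interpolates [f]
    at finitely many points by functions whose Pick kernel is positive on the
    whole upper half-plane, and a limit along an ultrafilter extends [f] itself.
    Positivity forces holomorphy without any complex integration: a Schur step at
    [a] exhibits the difference quotient at [a] as a Moebius function of another
    such function, which is Lipschitz by the Schwarz-Pick inequality.

    That the sums of kernels belong to [F(W)] reduces to rational functions with
    poles in the lower half-plane. Their inner products come from explicit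
    antiderivatives, and the logarithmic inequality, after factoring the
    numerator, from the Poisson integrals of [log |t - a|], which are computed by
    integrating the semigroup property of the Poisson kernel (Tonelli). *)

(** * Positive kernels and the Schur class *)

Section PositiveKernels.
Variables (C : numClosedFieldType) (X : eqType).
Implicit Types (K N : X -> X -> C) (s : seq (C * X)).

(** The pairing of [K(w, .)] with [T K(v, .) = K(v + i, .)] is [K(w, v + i)], whose denominator is
    [v + i - conj w] up to a constant. Its hermitian adjoint has the same denominator, so the two
    add up without loss. Moving every point up by [i/2] gives this denominator the shape
    [v' - conj w'] of a Pick kernel. The data then live on [Im z' > 1/2], whereas a Pick kernel
    makes sense on all of [Im z' > 0], that is on [Im z > -1/2]: the strip gained by the theorem is
    exactly this difference. The Cayley transform is what makes a compactness argument possible: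
    [phi] may be unbounded, but values in the closed unit disc always converge along an ultrafilter.
    Its price is two nonvanishing statements, [W z + W (z + i) != 0] in order to form it and
    [F != 1] in order to undo it. The first is read off the diagonal of the kernel, the second
    follows from the maximum principle. *)

Definition kernel_form K s : C :=
  \sum_(p <- s) \sum_(q <- s) p.1 * (q.1)^* * K p.2 q.2.

(** In [C] the relation [0 <= u] says that [u] is real and nonnegative. Lists may repeat points, so
    any image of a list is again a legitimate test. *)
Definition psd (A : X -> Prop) K : Prop :=
  forall s, (forall p, p \in s -> A p.2) -> 0 <= kernel_form K s.

Lemma psd_sub (A B : X -> Prop) K :
  (forall x, A x -> B x) -> psd B K -> psd A K.
Proof. by move=> AB KB s sA; apply: KB => p /sA /AB. Qed.

Lemma eq_kernel_form K N s :
  (forall p q, p \in s -> q \in s -> K p.2 q.2 = N p.2 q.2) ->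
  kernel_form K s = kernel_form N s.
Proof.
move=> KN; apply: eq_big_seq => p ps; apply: eq_big_seq => q qs.
by rewrite KN.
Qed.

Lemma eq_psd (A : X -> Prop) K N :
  (forall x y, A x -> A y -> K x y = N x y) -> psd A K -> psd A N.
Proof.
move=> KN KA s sA; rewrite -(@eq_kernel_form K); first exact: KA.
by move=> p q /sA ? /sA ?; apply: KN.
Qed.

Lemma psd0 (A : X -> Prop) : psd A (fun _ _ : X => 0).
Proof.
move=> s _; rewrite /kernel_form big1 // => p _.
by rewrite big1 // => q _; rewrite mulr0.
Qed.

Lemma kernel_form_rank1 (v : X -> C) s :
  kernel_form (fun x y => v x * (v y)^*) s = `|\sum_(p <- s) p.1 * v p.2| ^+ 2.
Proof.
rewrite normCK rmorph_sum /= mulr_suml; apply: eq_bigr => p _.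
by rewrite mulr_sumr; apply: eq_bigr => q _; rewrite rmorphM /=; ring.
Qed.

Lemma kernel_formD K N s :
  kernel_form (fun x y => K x y + N x y) s = kernel_form K s + kernel_form N s.
Proof.
rewrite -big_split /=; apply: eq_bigr => p _; rewrite -big_split /=.
by apply: eq_bigr => q _; rewrite mulrDr.
Qed.

Lemma kernel_formZ (a : C) K s :
  kernel_form (fun x y => a * K x y) s = a * kernel_form K s.
Proof.
rewrite mulr_sumr; apply: eq_bigr => p _; rewrite mulr_sumr.
by apply: eq_bigr => q _; rewrite mulrCA.
Qed.

Lemma kernel_form_congruence (e : X -> C) K s :
  kernel_form (fun x y => e x * (e y)^* * K x y) s =
  kernel_form K [seq (p.1 * e p.2, p.2) | p <- s].
Proof.
rewrite /kernel_form big_map; apply: eq_bigr => p _; rewrite big_map.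
by apply: eq_bigr => q _; rewrite rmorphM /=; ring.
Qed.

Lemma psd_congruence (A : X -> Prop) (e : X -> C) K :
  psd A K -> psd A (fun x y => e x * (e y)^* * K x y).
Proof.
move=> KA s sA; rewrite kernel_form_congruence; apply: KA => p /mapP[q qs ->].
exact: (sA q).
Qed.

Lemma psdZ (A : X -> Prop) K (c : C) : 0 <= c -> psd A K ->
  psd A (fun x y => c * K x y).
Proof. by move=> c0 KA s sA; rewrite kernel_formZ mulr_ge0 // KA. Qed.

Lemma kernel_form_conj K s :
  (kernel_form K s)^* = kernel_form (fun x y => (K y x)^*) s.
Proof.
rewrite /kernel_form rmorph_sum /= exchange_big /=; apply: eq_bigr => p _.
rewrite rmorph_sum /=; apply: eq_bigr => q _.
by rewrite !rmorphM /= conjCK [_ * q.1]mulrC.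
Qed.

Lemma psd_diag (A : X -> Prop) K x : psd A K -> A x -> 0 <= K x x.
Proof.
move=> KA Ax; have := KA [:: (1, x)]; rewrite /kernel_form !big_seq1 /=.
by rewrite rmorph1 !mul1r; apply=> p; rewrite inE => /eqP ->.
Qed.

(** Tested on [(K y y, - K x y)], the form is the 2x2 determinant times [K y y]. If [K y y = 0] this
    says nothing and the roles of [x] and [y] are exchanged; if both diagonal entries vanish,
    [(1, - K x y)] gives [- 2 |K x y|^2 >= 0]. *)
Lemma psd_Cauchy_Schwarz (A : X -> Prop) K x y : psd A K -> A x -> A y ->
  K y x = (K x y)^* -> `|K x y| ^+ 2 <= K x x * K y y.
Proof.
move=> KA Ax Ay Kyx.
have Kx := psd_diag KA Ax; have Ky := psd_diag KA Ay.
have form2 c d : 0 <= c * c^* * K x x + c * d^* * K x y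
                   + d * c^* * K y x + d * d^* * K y y.
  have := KA [:: (c, x); (d, y)]; rewrite /kernel_form !big_cons !big_nil /=.
  rewrite !addr0 !addrA; apply=> p; rewrite !inE => /orP[] /eqP -> //.
have Kxr : (K x x)^* = K x x by apply: conj_Creal; rewrite realE Kx.
have Kyr : (K y y)^* = K y y by apply: conj_Creal; rewrite realE Ky.
have Kgt0 t : 0 <= t -> t != 0 -> 0 < t :> C by rewrite lt0r => -> ->.
set k := K x y in Kyx form2 *; have kk : `|k| ^+ 2 = k * k^* by rewrite normCK.
have [y0|yN0] := eqVneq (K y y) 0.
  have [x0|xN0] := eqVneq (K x x) 0.
    have := form2 1 (- k); rewrite Kyx x0 y0 rmorphN rmorph1 kk /=.
    rewrite (_ : _ + _ = - (2 * (k * k^*))); last by ring.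
    by rewrite oppr_ge0 pmulr_rle0 // mul0r.
  have := form2 (- k^*) (K x x); rewrite Kyx y0 rmorphN /= conjCK Kxr kk !mulr0.
  rewrite (_ : _ + _ = - (k * k^*) * K x x); last by ring.
  by rewrite pmulr_lge0 ?Kgt0 // oppr_ge0.
have := form2 (K y y) (- k); rewrite Kyx rmorphN /= Kyr kk.
rewrite (_ : _ + _ = (K x x * K y y - k * k^*) * K y y); last by ring.
by rewrite pmulr_lge0 ?Kgt0 // subr_ge0.
Qed.

(* The Schur complement of [K] at [a] is congruent to [N] through [e]. *)
Section SchurComplement.
Variables (K N : X -> X -> C) (a : X) (e : X -> C) (A : X -> Prop).
Hypotheses (Kaa : 0 < K a a).
Hypothesis KN : forall x y, A x \/ x = a -> A y \/ y = a ->
  K x y = (K a a)^-1 * (K x a * (K y a)^*) + e x * (e y)^* * N x y.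

Let form_KN s : (forall p, p \in s -> A p.2 \/ p.2 = a) ->
  kernel_form K s = (K a a)^-1 * `|\sum_(p <- s) p.1 * K p.2 a| ^+ 2
                    + kernel_form N [seq (p.1 * e p.2, p.2) | p <- s].
Proof.
move=> sA; rewrite (eq_kernel_form (N := fun x y =>
  (K a a)^-1 * (K x a * (K y a)^*) + e x * (e y)^* * N x y)); last first.
  by move=> p q /sA pA /sA qA; apply: KN.
by rewrite kernel_formD kernel_formZ kernel_form_rank1 kernel_form_congruence.
Qed.

Lemma psd_of_complement : psd A N -> A a -> psd A K.
Proof.
move=> NA Aa s sA; rewrite form_KN => [|p /sA]; last by left.
rewrite addr_ge0 ?mulr_ge0 ?exprn_ge0 ?invr_ge0 ?(ltW Kaa) //.
by apply: NA => p /mapP[q /sA qA ->].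
Qed.

Lemma psd_complement : e a = 0 -> (forall x, A x -> e x != 0) ->
  psd (fun x => A x \/ x = a) K -> psd A N.
Proof.
move=> ea0 eN0 KA s sA.
pose t := [seq (p.1 / e p.2, p.2) | p <- s].
(* This coefficient at [a] cancels the rank-one term, and since [e a = 0] the added point leaves the
   [N] part unchanged. *)
pose c := - (\sum_(p <- t) p.1 * K p.2 a) / K a a.
have tA p : p \in t -> A p.2 by move=> /mapP[q /sA ? ->].
have ctA p : p \in (c, a) :: t -> A p.2 \/ p.2 = a.
  by rewrite inE => /predU1P[->|/tA]; [right|left].
have := KA _ ctA; rewrite (form_KN ctA) big_cons /= /c divfK ?gt_eqF //.
rewrite addNr normr0 expr0n mulr0 add0r ea0 mulr0 -map_comp.
rewrite (_ : map _ s = s); last first.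
  rewrite -[RHS]map_id; apply/eq_in_map => p /sA /eN0 ep /=.
  by rewrite divfK // -surjective_pairing.
rewrite /kernel_form big_cons big1_seq ?add0r => [|q _]; last by rewrite !mul0r.
by under eq_bigr do rewrite big_cons conjC0 mulr0 mul0r add0r.
Qed.

End SchurComplement.
End PositiveKernels.

Lemma psd_comp (D : numClosedFieldType) (X Y : eqType) (g : X -> Y)
    (A : X -> Prop) (B : Y -> Prop) (K : Y -> Y -> D) :
  (forall x, A x -> B (g x)) -> psd B K -> psd A (fun x y => K (g x) (g y)).
Proof.
move=> AB KB s sA; have := KB [seq (p.1, g p.2) | p <- s].
rewrite /kernel_form big_map; under eq_bigr do rewrite big_map.
by apply=> p /mapP[q /sA /AB ? ->].
Qed.

(** * The Schur class of the upper half-plane, treated algebraically *)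

Section SchurClass.
Variable C : numClosedFieldType.
Implicit Types (f g h F : C -> C) (z w a : C) (A : C -> Prop).

Definition upper z : Prop := 0 < 'Im z.

Definition schur_kernel f z w : C := (1 - f z * (f w)^*) * ('i / (z - w^*)).

Definition blaschke a z : C := (z - a) / (z - a^*).

Lemma upperB_neq0 z w : upper z -> upper w -> z - w^* != 0.
Proof.
move=> zU wU; apply: contraTneq (addr_gt0 zU wU) => zw.
have -> : 'Im z + 'Im w = 'Im (z - w^*) by rewrite raddfB /= Im_conj opprK.
by rewrite zw raddf0 ltxx.
Qed.

Lemma subC_conj z : z - z^* = 2 * 'i * 'Im z.
Proof. by rewrite [in LHS](Crect z) conjC_rect ?Creal_Re ?Creal_Im //; ring. Qed.

Lemma schur_kernelC f z w : schur_kernel f w z = (schur_kernel f z w)^*.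
Proof.
rewrite /schur_kernel !(rmorphM, rmorphB, rmorph1, fmorphV) /= !conjCK conjCi.
by rewrite -[w - _]opprB invrN mulrN mulNr [_ * f w]mulrC.
Qed.

Lemma schur_kernel_diag f z :
  schur_kernel f z z = (1 - `|f z| ^+ 2) / (2 * 'Im z).
Proof.
rewrite /schur_kernel -normCK subC_conj; congr (_ * _).
by rewrite -mulrA mulrCA invfM mulrA divff ?mul1r ?neq0Ci.
Qed.

Lemma schur_kernel_norm f z w : `|schur_kernel f z w| ^+ 2 =
  `|1 - f z * (f w)^*| ^+ 2 / `|z - w^*| ^+ 2.
Proof. by rewrite normrM normf_div normCi div1r exprMn exprVn. Qed.

Lemma schur_le1 A f z : (forall x, A x -> upper x) ->
  psd A (schur_kernel f) -> A z -> `|f z| <= 1.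
Proof.
move=> AU fA Az; have := psd_diag fA Az; rewrite schur_kernel_diag.
rewrite pmulr_lge0 ?invr_gt0 ?mulr_gt0 ?ltr0n ?AU // subr_ge0.
by rewrite expr_le1.
Qed.

Lemma psd_schur_const A (c : C) : `|c| = 1 -> psd A (schur_kernel (fun=> c)).
Proof.
move=> c1; apply: (@eq_psd C C A (fun _ _ => 0)) => [z w _ _|]; last exact: psd0.
by rewrite /schur_kernel -normCK c1 expr1n subrr mul0r.
Qed.

(** Maximum principle from positivity: [|f a| = 1] annihilates the diagonal entry at [a], and
    Cauchy-Schwarz then forces [f z * conj (f a) = 1]. *)
Lemma schur_maximum A f a z : (forall x, A x -> upper x) ->
  psd A (schur_kernel f) -> A a -> `|f a| = 1 -> A z -> f z = f a.
Proof.
move=> AU fA Aa fa1 Az.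
have := psd_Cauchy_Schwarz fA Az Aa (schur_kernelC _ _ _).
rewrite [X in _ * X]schur_kernel_diag fa1 expr1n subrr mul0r mulr0.
rewrite schur_kernel_norm pmulr_lle0; last first.
  by rewrite invr_gt0 exprn_gt0 // normr_gt0 upperB_neq0 //; apply: AU.
move=> n0; have /eqP : `|1 - f z * (f a)^*| ^+ 2 = 0.
  by apply/eqP; rewrite eq_le n0 exprn_ge0.
rewrite sqrf_eq0 normr_eq0 subr_eq0 => /eqP fz.
by rewrite -[f z]mulr1 -(expr1n _ 2) -fa1 normCK [f a * _]mulrC mulrA -fz mul1r.
Qed.

Lemma blaschke_neq0 a z : upper a -> upper z -> z != a -> blaschke a z != 0.
Proof. by move=> aU zU za; rewrite mulf_neq0 ?invr_eq0 ?upperB_neq0 ?subr_eq0. Qed.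

Lemma mul_conj_neq1 (x y : C) : `|x| < 1 -> `|y| <= 1 -> 1 - x^* * y != 0.
Proof.
move=> x1 y1; rewrite subr_eq0 eq_sym; apply/eqP => xy.
have : `|x^* * y| < 1.
  rewrite normrM norm_conjC; apply: le_lt_trans x1.
  by rewrite ler_piMr.
by rewrite xy normr1 ltxx.
Qed.

(* Schur's algorithm: [h] is the Blaschke quotient at [a] of the Moebius
   transform of [f] which vanishes at [a]. *)
Section SchurStep.
Variables (f h : C -> C) (a : C) (A : C -> Prop).
Hypotheses (AU : forall z, A z -> upper z) (aU : upper a) (fa1 : `|f a| < 1).
Hypothesis fh : forall z, A z \/ z = a ->
  f z - f a = blaschke a z * h z * (1 - (f a)^* * f z).

Let e z := blaschke a z * (1 - (f a)^* * f z).
Let N z w := (1 - `|f a| ^+ 2)^-1 * schur_kernel h z w.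

Let fa_gt0 : 0 < 1 - `|f a| ^+ 2.
Proof. by rewrite subr_gt0 expr_lt1. Qed.

Let f_complement z w : A z \/ z = a -> A w \/ w = a ->
  schur_kernel f z w = (schur_kernel f a a)^-1 *
    (schur_kernel f z a * (schur_kernel f w a)^*) + e z * (e w)^* * N z w.
Proof.
move=> zA wA.
have zU : upper z by case: zA => [/AU|->].
have wU : upper w by case: wA => [/AU|->].
have zw := upperB_neq0 zU wU; have za := upperB_neq0 zU aU.
have aw := upperB_neq0 aU wU; have aa := upperB_neq0 aU aU.
have wa : w^* - a != 0 by rewrite -opprB oppr_eq0.
have ii : 'i != 0 :> C := neq0Ci C.
have := fa_gt0; move/lt0r_neq0; rewrite normCK => k0.
(* By [fh] the terms containing [h] turn into [f z - f a] and [f w - f a]; what remains is a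
   rational identity in values of [f] and points. *)
have -> : e z * (e w)^* * N z w = (1 - `|f a| ^+ 2)^-1 *
    ((e z * (e w)^* - (f z - f a) * (f w - f a)^*) * ('i / (z - w^*))).
  rewrite (fh zA) (fh wA) /N /schur_kernel /e !rmorphM /=.
  by rewrite !(rmorphB, rmorphM, rmorph1) /=; ring.
rewrite -schur_kernelC /schur_kernel /e /blaschke normCK.
rewrite !(rmorphM, rmorphB, rmorph1, fmorphV) /= !conjCK.
by field; rewrite ?k0 ?zw ?za ?aw ?aa ?wa ?ii.
Qed.

Let Kaa : 0 < schur_kernel f a a.
Proof. by rewrite schur_kernel_diag divr_gt0 // mulr_gt0 ?ltr0n. Qed.

Lemma psd_schur_step : A a -> psd A (schur_kernel h) -> psd A (schur_kernel f).
Proof.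
move=> Aa hA; apply: (psd_of_complement Kaa f_complement) => // s sA.
by rewrite kernel_formZ mulr_ge0 ?invr_ge0 ?(ltW fa_gt0) //; apply: hA.
Qed.

Lemma psd_schur_unstep : (forall z, A z -> z != a) ->
  psd (fun z => A z \/ z = a) (schur_kernel f) -> psd A (schur_kernel h).
Proof.
move=> Aa fA.
have AaU z : A z \/ z = a -> upper z by case=> [/AU|->].
suff NA : psd A N.
  move=> s /NA; rewrite kernel_formZ pmulr_rge0 // invr_gt0 //.
apply: (psd_complement Kaa f_complement _ _ fA) => [|z Az].
  by rewrite /e /blaschke subrr !mul0r.
rewrite mulf_neq0 ?blaschke_neq0 ?Aa //; first exact: AU.
by apply: mul_conj_neq1 => //; apply: (schur_le1 AaU fA); left.
Qed.

End SchurStep.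

Lemma normB_conj z w : `|z - w^*| ^+ 2 = `|z - w| ^+ 2 + 4 * 'Im z * 'Im w.
Proof.
have zE := subC_conj z; have wE := subC_conj w.
have -> : 4 * 'Im z * 'Im w = - (2 * 'i * 'Im z) * (2 * 'i * 'Im w).
  by transitivity (4 * - 'i ^+ 2 * 'Im z * 'Im w); [rewrite sqrCi; ring|ring].
by rewrite -zE -wE !normCK !rmorphB /= !conjCK; ring.
Qed.

Lemma blaschke_le1 a z : upper a -> upper z -> `|blaschke a z| <= 1.
Proof.
move=> aU zU; rewrite normf_div ler_pdivrMr ?normr_gt0 ?upperB_neq0 // mul1r.
rewrite -(@ler_pXn2r _ 2) ?nnegrE // normB_conj lerDl.
by rewrite !mulr_ge0 ?ler0n ?ltW.
Qed.

Definition moebius (c x : C) : C := (x + c) / (1 + c^* * x).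

Lemma moebiusK (c x y : C) : 1 + c^* * x != 0 -> 1 - `|c| ^+ 2 != 0 ->
  moebius c x - c = x * (1 - c^* * moebius c x).
Proof. by rewrite normCK /moebius => x0 c0; field. Qed.

(** Induction on the list: [psd_schur_unstep] at [a] leaves data on one point fewer, and
    [psd_schur_step] carries an interpolant [H] of these data back. If [|f a| = 1] no step exists,
    but then [f] is constant on the list by the maximum principle. *)
Lemma schur_interpolation (s : seq C) f : (forall z, z \in s -> upper z) ->
  psd (fun z => z \in s) (schur_kernel f) ->
  exists2 F, psd upper (schur_kernel F) & {in s, F =1 f}.
Proof.
elim: s f => [|a s IHs] f sU fs.
  by exists (fun=> 1) => //; apply: psd_schur_const; rewrite normr1.
have sU' z : z \in s -> upper z by move=> zs; apply: sU; rewrite inE zs orbT.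
have sub z : z \in s -> z \in a :: s by rewrite inE orbC => ->.
have [as_|asN] := boolP (a \in s).
  have [F FU Ff] := IHs f sU' (psd_sub sub fs); exists F => // z.
  by rewrite inE => /predU1P[->|]; apply: Ff.
have aU : upper a by apply: sU; rewrite mem_head.
have := schur_le1 sU fs (mem_head _ _); rewrite le_eqVlt => /predU1P[fa1|fa1].
  exists (fun=> f a) => [|z zs]; last first.
    by rewrite (schur_maximum sU fs (mem_head _ _) fa1 zs).
  exact: psd_schur_const.
have f1 z : z \in a :: s -> 1 - (f a)^* * f z != 0.
  by move=> /(schur_le1 sU fs); apply: mul_conj_neq1.
pose h z := (f z - f a) / (1 - (f a)^* * f z) / blaschke a z.
have bN0 z : z \in s -> blaschke a z != 0.
  move=> zs; apply: blaschke_neq0 => //; first exact: sU'.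
  by apply: contraNneq asN => <-.
have hs : psd (fun z => z \in s) (schur_kernel h).
  apply: (@psd_schur_unstep f h a) => //.
  - move=> z [zs|->]; last by rewrite /blaschke !subrr !mul0r.
    by rewrite /h; field; rewrite bN0 ?f1 ?sub.
  - by move=> z zs; apply: contraNneq asN => <-.
  - by apply: psd_sub fs => z [zs|->]; rewrite ?mem_head ?sub.
have [H HU Hh] := IHs h sU' hs.
have k0 : 1 - `|f a| ^+ 2 != 0 by rewrite lt0r_neq0 // subr_gt0 expr_lt1.
have b1 z : upper z -> 1 + (f a)^* * (blaschke a z * H z) != 0.
  move=> zU; rewrite -[_ * H z]opprK mulrN mul_conj_neq1 // normrN normrM.
  by rewrite mulr_ile1 // ?blaschke_le1 // (schur_le1 _ HU).
pose F z := moebius (f a) (blaschke a z * H z).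
have Fa : F a = f a.
  by rewrite /F /moebius /blaschke subrr !mul0r mulr0 addr0 add0r divr1.
exists F => [|z].
  apply: (@psd_schur_step F H a) => //; rewrite Fa // => z zU.
  by rewrite /F moebiusK // b1 //; case: zU => [|->].
rewrite inE => /predU1P[->//|zs].
rewrite /F Hh // [_ * h z]mulrC /h divfK ?bN0 // /moebius.
have := f1 _ (sub _ zs); move: k0; rewrite normCK => k0 fz; field.
by rewrite fz [X in X != 0](_ : _ = 1 - f a * (f a)^*) //=; ring.
Qed.

(* Schwarz-Pick: [|1 - f z conj(f w)|^2 = |f z - f w|^2 + (1 - |f z|^2)(1 - |f w|^2)]
   and the denominators satisfy the analogous identity [normB_conj]. *)
Lemma schur_Lipschitz f z w : psd upper (schur_kernel f) -> upper z -> upper w ->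
  `|f z - f w| ^+ 2 * (4 * 'Im z * 'Im w) <= `|z - w| ^+ 2.
Proof.
move=> fU zU wU.
have := psd_Cauchy_Schwarz fU zU wU (schur_kernelC _ _ _).
have zw : 0 < `|z - w^*| ^+ 2 by rewrite exprn_gt0 ?normr_gt0 ?upperB_neq0.
have fz1 := schur_le1 (fun _ => id) fU zU; have fw1 := schur_le1 (fun _ => id) fU wU.
rewrite schur_kernel_norm !schur_kernel_diag ler_pdivrMr // normB_conj.
have -> : `|1 - f z * (f w)^*| ^+ 2 =
    `|f z - f w| ^+ 2 + (1 - `|f z| ^+ 2) * (1 - `|f w| ^+ 2).
  by rewrite !normCK !(rmorphB, rmorphM, rmorph1) /= !conjCK; ring.
set D := `|f z - f w| ^+ 2; set P := (1 - _) * (1 - _); set Q := `|z - w| ^+ 2.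
have z0 : 'Im z != 0 := lt0r_neq0 zU; have w0 : 'Im w != 0 := lt0r_neq0 wU.
rewrite [X in _ <= X](_ : _ = P + P * Q / (4 * 'Im z * 'Im w)); last first.
  by rewrite /P; field; rewrite z0 w0.
(* Cancelling [P] leaves [D * (4 Im z Im w) <= P * Q], and [P <= 1]. *)
rewrite [D + P]addrC lerD2l ler_pdivlMr ?mulr_gt0 ?ltr0n // => DP.
apply: (le_trans DP); rewrite ler_piMl ?exprn_ge0 //.
by rewrite mulr_ile1 ?subr_ge0 ?gerBl ?exprn_ge0 ?expr_le1.
Qed.

End SchurClass.

(** * Conjugation identities for the accretive kernel and its Cayley transform *)

Section ConjugationIdentities.
Variable D : numClosedFieldType.

Lemma conj_mul_div (c w k : D) : k^* = - k ->
  Num.conj (Num.conj c * (- Num.conj w / k)) = c * (w / k).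
Proof.
move=> kk; rewrite !(rmorphM, rmorphN, fmorphV) /= !conjCK kk.
by rewrite invrN mulrNN.
Qed.

Lemma conj_half_kernel (a b x y k : D) :
  k^* = - k ->
  Num.conj (a * Num.conj b * (k / (x + k - Num.conj y))) =
  b * Num.conj a * (k / (y + k - Num.conj x)).
Proof.
move=> kk; rewrite !(rmorphM, rmorphD, rmorphN, fmorphV) /= !conjCK kk.
have -> : Num.conj x - k - y = - (y + k - Num.conj x) by ring.
by rewrite invrN mulrNN [_ * b]mulrC.
Qed.

(** Polarization: [2 (b conj c + a conj d) = (a + b) conj (c + d) - (a - b) conj (c - d)]. *)
Lemma schur_cayley (a b c d k : D) :
  a + b != 0 -> c + d != 0 ->
  (a + b)^-1 * Num.conj (c + d)^-1 *
    (2 * ((b * Num.conj c + a * Num.conj d) * k)) =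
  (1 - (a - b) / (a + b) * Num.conj ((c - d) / (c + d))) * k.
Proof.
move=> ab cd; have : Num.conj (c + d) != 0 by rewrite conjC_eq0.
rewrite !(rmorphM, fmorphV, rmorphB) /= rmorphD => cd'.
by field; rewrite ab cd'.
Qed.

Lemma cayley_addJ_ge0 (u : D) : 1 - u != 0 -> `|u| <= 1 ->
  0 <= (1 + u) / (1 - u) + Num.conj ((1 + u) / (1 - u)).
Proof.
move=> u0 u1; have : Num.conj (1 - u) != 0 by rewrite conjC_eq0.
rewrite !(rmorphM, fmorphV, rmorphD, rmorphN, rmorph1) /= => u0'.
rewrite (_ : _ + _ = 2 * (1 - `|u| ^+ 2) / `|1 - u| ^+ 2); last first.
  by rewrite !normCK rmorphB rmorph1 /=; field; rewrite u0 u0'.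
by rewrite divr_ge0 ?exprn_ge0 // mulr_ge0 // subr_ge0 expr_le1.
Qed.

Lemma conjB_imag (y k : D) : k^* = - k ->
  Num.conj (y - k) = Num.conj y + k.
Proof. by move=> kk; rewrite rmorphB /= kk opprK. Qed.

End ConjugationIdentities.

Local Open Scope classical_set_scope.
Local Open Scope complex_scope.

(** * Extension and holomorphy of Schur functions *)

Lemma near_dist_lt (K : numDomainType) (V : pseudoMetricNormedZmodType K) (z : V)
  (e : K) : 0 < e -> \forall w \near z, `|z - w| < e.
Proof. by move=> e0; apply: (@cvgr_dist_lt K V V (nbhs z) _ id z cvg_id e e0). Qed.

Section ComplexTopology.
Variable R : realType.
Local Notation C := R[i].
Implicit Types (z w : C).

Lemma normC_isometry (phi : C -> C) : {morph phi : x y / x - y} ->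
  (forall x, `|phi x| = `|x|) -> continuous (phi : C^o -> C^o).
Proof.
move=> phiB phiN z; apply/(@cvgrPdist_lt C C^o C^o (nbhs (z : C^o))) => e e0; near=> w.
rewrite -phiB phiN; near: w.
exact: (@near_dist_lt C C^o).
Unshelve. all: by end_near. Qed.

Lemma continuous_conjC : continuous (Num.conj : C^o -> C^o).
Proof.
by apply: normC_isometry => [x y|x]; [rewrite rmorphB|rewrite norm_conjC].
Qed.

Lemma gt0_real_complex (e : C) : 0 < e -> e = (complex.Re e)%:C /\ 0 < complex.Re e.
Proof.
rewrite ltcE => /andP[/eqP ei er]; split=> //.
by case: e ei er => a b /= -> _.
Qed.

Lemma normc_real (x : R) : `|x%:C| = `|x|%:C.
Proof. by rewrite normc_def /= expr0n addr0 sqrtr_sqr. Qed.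

Lemma Im_le_norm z : `|complex.Im z|%:C <= `|z|.
Proof.
by rewrite normc_def lecR -sqrtr_sqr ler_wsqrtr // lerDr sqr_ge0.
Qed.

Lemma continuous_Im : continuous (@complex.Im R : C^o -> R).
Proof.
move=> z; apply/(@cvgrPdist_lt R R C^o (nbhs (z : C^o))) => e e0; near=> w.
rewrite -ltcR (_ : _ - _ = complex.Im (z - w)); last by rewrite raddfB.
apply: (le_lt_trans (Im_le_norm _)); near: w.
by apply: (@near_dist_lt C C^o); rewrite ltcR.
Unshelve. all: by end_near. Qed.

Lemma continuous_Re : continuous (@complex.Re R : C^o -> R).
Proof.
move=> z; apply/(@cvgrPdist_lt R R C^o (nbhs (z : C^o))) => e e0; near=> w.
rewrite -ltcR (_ : _ - _ = complex.Re (z - w)); last by rewrite raddfB.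
apply: (le_lt_trans (normc_ge_Re _)); near: w.
by apply: (@near_dist_lt C C^o); rewrite ltcR.
Unshelve. all: by end_near. Qed.

Lemma cvg_complex {T : Type} {F : set_system T} {FF : Filter F} (g h : T -> R)
    (a b : R) : g x @[x --> F] --> a -> h x @[x --> F] --> b ->
  ((g x +i* h x : C^o) @[x --> F]) --> (a +i* b : C^o).
Proof.
move=> ga hb; apply/(@cvgrPdist_lt C C^o T F) => e /gt0_real_complex[-> e0].
have e20 : 0 < complex.Re e / 2 by rewrite divr_gt0.
apply: filterS2 (cvgr_dist_lt _ _ ga _ e20) (cvgr_dist_lt _ _ hb _ e20).
move=> x gx hx; rewrite (_ : _ - _ = (a - g x) +i* (b - h x)) //.
rewrite [_ +i* _]complexE /=; apply: (le_lt_trans (ler_normD _ _)).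
rewrite normrM complexiE normCi mul1r !normc_real -rmorphD ltcR [ltRHS]splitr.
exact: ltrD.
Qed.

Lemma closed_Cge0 : closed [set z : C^o | 0 <= z].
Proof.
have -> : [set z : C^o | 0 <= z] =
    (@complex.Im R) @^-1` [set x | x = 0] `&` (@complex.Re R) @^-1` [set x | 0 <= x].
  apply/seteqP; split => z /=; rewrite lecE; first by move=> /andP[/eqP -> ->].
  by move=> [-> ->]; rewrite eqxx.
apply: closedI; (apply: closed_comp; last by [exact: closed_eq|exact: closed_ge]).
- by move=> z _; apply: continuous_Im.
- by move=> z _; apply: continuous_Re.
Qed.

Lemma upperE z : upper z <-> 0 < complex.Im z.
Proof. by rewrite /upper -complexIm -ltcR. Qed.

Lemma open_half_plane (a : R) : open (half_plane a : set C^o).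
Proof.
apply: (@open_comp _ _ _ [set x | a < x]); last exact: open_gt.
by move=> z _; apply: continuous_Im.
Qed.

End ComplexTopology.

Lemma ultra_fmap (T V : Type) (f : T -> V) (U : set_system T) :
  UltraFilter U -> UltraFilter (f @ U).
Proof.
move=> UU; split; first exact: fmap_proper_filter.
move=> G GP sub; apply/seteqP; split => [A GA|A]; last exact: sub.
have [//|UA] := in_ultra_setVsetC (f @^-1` A) UU.
have /filter_ex[x []//] : G (A `&` ~` A) by apply: filterI => //; apply: sub.
Qed.

Lemma cvg_sum_seq (K : numFieldType) (V : normedModType K) (T I : Type)
    (F : set_system T) (FF : Filter F) (r : seq I) (f : I -> T -> V) (l : I -> V) :
  (forall i, f i x @[x --> F] --> l i) ->
  \sum_(i <- r) f i x @[x --> F] --> \sum_(i <- r) l i.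
Proof.
move=> fl; elim: r => [|i r IHr].
  by rewrite big_nil; under eq_fun do rewrite big_nil; apply: cvg_cst.
by rewrite big_cons; under eq_fun do rewrite big_cons; apply: cvgD.
Qed.

(** * Extension of Schur functions by limits of interpolants *)

Section SchurExtension.
Variable R : realType.
Local Notation C := R[i].

Lemma ultra_bounded_cvg (T : Type) (U : set_system T) (g : T -> C) :
  UltraFilter U -> (forall t, `|g t| <= 1) ->
  exists l : C, (g t : C^o) @[t --> U] --> (l : C^o).
Proof.
move=> UU g1.
have cvg1 (h : T -> R) : (forall t, `|h t| <= 1) ->
    exists l : R, h t @[t --> U] --> l.
  move=> h1; have := @segment_compact R (-1) 1; rewrite compact_ultra.
  move=> /(_ _ (ultra_fmap h UU))[|l [_ hl]]; last by exists l.
  apply: (@filterE _ U _ (h @^-1` `[-1, 1])) => t.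
  by have := h1 t; rewrite /= in_itv /= ler_norml.
have [t|a ga] := cvg1 (fun t => complex.Re (g t)).
  by rewrite -lecR (le_trans (normc_ge_Re _)).
have [t|b gb] := cvg1 (fun t => complex.Im (g t)).
  by rewrite -lecR (le_trans (Im_le_norm _)).
exists (a +i* b); have := cvg_complex ga gb.
rewrite (_ : (fun t => _ +i* _) = g); last by apply/funext => t; case: (g t). exact.
Qed.

Lemma schur_kernel_cvg (T : Type) (U : set_system T) (FU : Filter U)
    (F : T -> C -> C) (f : C -> C) z w :
  (F t z : C^o) @[t --> U] --> (f z : C^o) ->
  (F t w : C^o) @[t --> U] --> (f w : C^o) ->
  (schur_kernel (F t) z w : C^o) @[t --> U] --> (schur_kernel f z w : C^o).
Proof.
move=> Fz Fw; apply: cvgMr_tmp; apply: (@cvgB C C^o); first exact: cvg_cst.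
apply: (@cvgM C T U FU (F^~ z) (fun t => (F t w)^*) (f z) ((f w)^*) Fz).
exact: (@continuous_cvg _ C^o C^o U FU (F^~ w) Num.conj (f w)
  (@continuous_conjC R (f w)) Fw).
Qed.

(* The interpolants at the finite subsets of [A] converge along an ultrafilter
   on these subsets, and positivity of the kernel passes to the limit. *)
Theorem schur_extension (A : C -> Prop) (f : C -> C) :
  (forall z, A z -> upper z) -> psd A (schur_kernel f) ->
  exists2 F, psd (@upper C) (schur_kernel F) & forall z, A z -> F z = f z.
Proof.
move=> AU fA.
have interp (s : seq C) : exists F : C -> C, [/\ psd (@upper C) (schur_kernel F),
    forall z, `|F z| <= 1 & forall z, A z -> z \in s -> F z = f z].
  pose sA := [seq z <- s | `[< A z >]].
  have sAA z : z \in sA -> A z by rewrite mem_filter => /andP[/asboolP].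
  have [||F FU Ff] := @schur_interpolation C sA f.
  - by move=> z /sAA /AU.
  - exact: psd_sub fA.
  (* The value 0 off the upper half-plane keeps [|F z| <= 1] at every [z], so that a limit can be
     taken at every point. *)
  exists (fun z => if `[< upper z >] then F z else 0); split.
  - apply: eq_psd FU => z w zU wU.
    by rewrite /schur_kernel; do 2 (case: asboolP => // _).
  - move=> z; case: asboolP => [zU|_]; last by rewrite normr0.
    exact: schur_le1 FU zU.
  - move=> z Az zs; case: asboolP => [_|/(_ (AU _ Az))//].
    by apply: Ff; rewrite mem_filter zs andbT; apply/asboolP.
have [F Fprop] := choice interp.
(* A set is in this filter when it contains all lists that include some given finite list; hence at
   a fixed point of [A] the interpolants eventually equal [f]. *)
pose Phi : set_system (seq C) :=
  filter_from setT (fun s0 : seq C => [set s : seq C | {subset s0 <= s}]).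
have PhiP : ProperFilter Phi.
  apply: filter_from_proper; last by move=> s _; exists s.
  apply: filter_from_filter; first by exists [::].
  move=> s t _ _; exists (s ++ t) => // u stu; split=> x xs; apply: stu.
    by rewrite mem_cat xs.
  by rewrite mem_cat xs orbT.
have [U [UU PhiU]] := ultraFilterLemma PhiP.
have limF z : exists l : C, (F s z : C^o) @[s --> U] --> (l : C^o).
  by apply: ultra_bounded_cvg => s; have [_ ->] := Fprop s.
have [G FG] := choice limF.
exists G => [s sU|z Az].
  apply: (@closed_cvg _ C^o U _ (fun t => kernel_form (schur_kernel (F t)) s) _
    (@closed_Cge0 R)).
    by apply: filterE => t /=; have [+ _ _] := Fprop t; apply.
  apply: (@cvg_sum_seq C C^o _ _ U _ s (fun p t =>
    \sum_(q <- s) p.1 * (q.1)^* * schur_kernel (F t) p.2 q.2)) => p.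
  apply: (@cvg_sum_seq C C^o _ _ U _ s (fun q t =>
    p.1 * (q.1)^* * schur_kernel (F t) p.2 q.2)) => q.
  by apply: cvgMl_tmp; exact: schur_kernel_cvg.
apply: (@cvg_unique C^o (@norm_hausdorff _ _) (F^~ z @ U)); first exact: FG.
apply: (@cvg_near_cst _ C^o); apply: PhiU; exists [:: z] => // s zs /=.
by have [_ _ Fs] := Fprop s; apply: Fs => //; apply: zs; rewrite mem_head.
Qed.

End SchurExtension.

(** * Continuity and complex differentiability of Schur functions *)

Section SchurHolomorphic.
Variable R : realType.
Local Notation C := R[i].

Lemma near_upper (a : C) : upper a -> \forall z \near (a : C^o), upper z.
Proof.
move=> /upperE aU; near=> z; apply/upperE; near: z.
exact: (open_nbhs_nbhs (conj (@open_half_plane R 0) aU)).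
Unshelve. all: by end_near. Qed.

(** Near [a] one has [Im a <= 4 Im z], and the Schwarz-Pick inequality becomes
    [|F a - F z| * Im a <= |a - z|]. *)
Lemma schur_continuous (F : C -> C) (a : C) : psd (@upper C) (schur_kernel F) ->
  upper a -> {for a, continuous (F : C^o -> C^o)}.
Proof.
move=> FU aU; apply/(@cvgrPdist_lt C C^o C^o (nbhs (a : C^o))) => e e0.
have ia0 : 0 < complex.Im a by apply/upperE.
near=> z.
have zU : upper z by near: z; exact: near_upper.
have za : `|a - z| < e * 'Im a.
  by near: z; apply: (@near_dist_lt C C^o); rewrite mulr_gt0.
have iz : 'Im a <= 4 * 'Im z.
  rewrite -!complexIm -[4]/(4%:R) -(rmorph_nat (real_complex R) 4).
  rewrite -rmorphM lecR mulrC -ler_pdivrMr ?ltr0n //; apply: ltW; near: z.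
  apply: (open_nbhs_nbhs (conj (@open_half_plane R (complex.Im a / 4)) _)).
  by rewrite /half_plane /= gtr_pMr // invf_lt1 ?ltr0n // ltr1n.
rewrite -(@ltr_pXn2r _ 2) ?nnegrE ?(ltW e0) //.
have aa : 0 < 'Im a * 'Im a by rewrite mulr_gt0.
rewrite -(ltr_pM2r aa).
apply: le_lt_trans (_ : `|a - z| ^+ 2 < _); last first.
  rewrite -expr2 -exprMn ltr_pXn2r ?nnegrE ?normr_ge0 //.
  by rewrite mulr_ge0 // ltW.
apply: le_trans (schur_Lipschitz FU aU zU).
rewrite ler_wpM2l ?exprn_ge0 //.
by rewrite mulrAC [leRHS]mulrC ler_wpM2l // ltW.
Unshelve. all: by end_near. Qed.

Lemma continuous_subr (c : C) : continuous ((fun z => z - c) : C^o -> C^o).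
Proof.
move=> z; apply/(@cvgrPdist_lt C C^o C^o (nbhs (z : C^o))) => e e0.
apply: filterS (@near_dist_lt C C^o z e e0) => w.
by rewrite opprB addrA subrK.
Qed.

(** Caratheodory's form of the derivative: the difference quotient at [a] is [K] itself. *)
Lemma derivable_mulB (K : C -> C) (a : C) : {for a, continuous (K : C^o -> C^o)} ->
  derivable ((fun z => (z - a) * K z) : C^o -> C^o) a 1.
Proof.
move=> Ka; apply/cvg_ex; exists (K a).
have Kh : (K (h + a) : C^o) @[h --> (0 : C^o)^'] --> (K a : C^o).
  have ha : (h + a : C^o) @[h --> (0 : C^o)] --> (a : C^o).
    apply/(@cvgrPdist_lt C C^o C^o (nbhs (0 : C^o))) => e e0.
    apply: filterS (@near_dist_lt C C^o 0 e e0) => h.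
    by rewrite opprD addrCA subrr addr0 sub0r.
  by move=> P /Ka KP; apply: nbhs_dnbhs; apply: ha KP.
apply: cvg_trans Kh; apply: near_eq_cvg; near=> h.
have h0 : h != 0 by near: h; exact: nbhs_dnbhs_neq.
rewrite /= subrr mul0r subr0 /GRing.scale /= mulr1 addrK mulrA mulVf //.
by rewrite mul1r.
Unshelve. all: by end_near. Qed.

Theorem schur_holomorphic (F : C -> C) : psd (@upper C) (schur_kernel F) ->
  holomorphic_on (@upper_half_plane R) F.
Proof.
move=> FU a /upperE aU.
have := schur_le1 (fun _ => id) FU aU; rewrite le_eqVlt => /predU1P[Fa1|Fa1].
  apply: (@near_eq_derivable C C^o C^o (cst (F a))); last exact: derivable_cst.
  near=> z; symmetry; apply: (schur_maximum (fun _ => id) FU aU Fa1).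
  by near: z; apply: near_upper.
pose h z := (F z - F a) / (1 - (F a)^* * F z) / blaschke a z.
have F1 z : upper z -> 1 - (F a)^* * F z != 0.
  by move=> zU; apply: mul_conj_neq1 => //; apply: schur_le1 FU zU.
(* At [a] the quotient [h] is 0/0, so its kernel is positive only on the punctured half-plane;
   [schur_extension] fills the missing point. *)
pose A z := upper z /\ z != a.
have hA : psd A (schur_kernel h).
  apply: (@psd_schur_unstep C F h a) => //.
  - by move=> z [].
  - move=> z [[zU za]|->]; last by rewrite /blaschke !subrr !mul0r.
    by rewrite /h; field; rewrite blaschke_neq0 ?F1.
  - by move=> z [].
  - by apply: psd_sub FU => z [[]|->].
have [H HU Hh] := schur_extension (fun z => @proj1 _ _) hA.
(* [G] is [blaschke a * H] with the factor [z - a] isolated: its cofactor is continuous at [a], so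
   [derivable_mulB] applies, and [F] is a Moebius function of [G]. *)
pose G z := (z - a) * (H z / (z - a^*)).
have k0 : 1 - `|F a| ^+ 2 != 0 by rewrite lt0r_neq0 // subr_gt0 expr_lt1.
have GF z : upper z -> F z = (G z + F a) / (1 + (F a)^* * G z).
  move=> zU; have [->|za] := eqVneq z a.
    by rewrite /G subrr !mul0r mulr0 addr0 add0r divr1.
  rewrite /G Hh // /h /blaschke.
  have := F1 _ zU; move: k0; rewrite normCK => k0 Fz.
  have zz := upperB_neq0 zU aU; have {}za : z - a != 0 by rewrite subr_eq0.
  field; rewrite Fz zz za /= [X in X != 0](_ : _ = 1 - F a * (F a)^*) //=; ring.
have Gd : derivable (G : C^o -> C^o) a 1.
  apply: derivable_mulB.
  apply: (@cvgM C C^o (nbhs (a : C^o)) _ H (fun z => (z - a^*)^-1) (H a)).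
    exact: (schur_continuous HU aU).
  apply: (@cvgV C C^o (nbhs (a : C^o)) _ (fun z => z - a^*)).
    exact: upperB_neq0.
  exact: (@continuous_subr _ a).
apply: (@near_eq_derivable C C^o C^o
  (fun z => (G z + F a) * (1 + (F a)^* * G z)^-1)).
  by near=> z; rewrite [RHS]GF //; near: z; apply: near_upper.
apply: (@derivableM C C^o).
  by apply: (@derivableD C C^o); [|exact: derivable_cst].
apply: (@derivableV C C^o).
  by rewrite /G subrr mul0r mulr0 addr0 oner_neq0.
apply: (@derivableD C C^o); first exact: derivable_cst.
by apply: (@derivableM C C^o); first exact: derivable_cst.
Unshelve. all: by end_near. Qed.

End SchurHolomorphic.

(** * Integrals of rational functions on the real line *)

Section RealIntegrals.
Variable R : realType.
Local Notation mu := (@lebesgue_measure R).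

Lemma is_derive_continuous (f : R -> R) (df : R -> R) :
  (forall x : R, is_derive x 1 f (df x)) -> continuous f.
Proof.
by move=> fd x; apply: differentiable_continuous; apply/derivable1_diffP/ex_derive.
Qed.

(** Once [f] is integrable, dominated convergence reduces the integral to a symmetric limit. The
    logarithms belonging to different poles, each unbounded, can therefore be handled separately.
    The bounds [n.+1] keep every interval nondegenerate. *)
Lemma integral_antiderivative (f F : R -> R) (l : R) :
  mu.-integrable setT (EFin \o f) -> continuous f ->
  (forall x : R, is_derive x 1 F (f x)) ->
  (F n.+1%:R - F (- n.+1%:R)) @[n --> \oo] --> l ->
  \int[mu]_x f x = l.
Proof.
move=> fi fc dF Fl.
have /integrableP[mf _] := fi.
pose I (n : nat) : set R := `[- n.+1%:R, n.+1%:R]%classic.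
pose g n := EFin \o (f \_ (I n)).
have mI n : measurable (I n) by exact: measurable_itv.
have cF := is_derive_continuous dF.
have gE n : (\int[mu]_x g n x = (F n.+1%:R - F (- n.+1%:R))%:E)%E.
  rewrite /g -restrict_EFin -integral_mkcond (@continuous_FTC2 _ f F) //.
  - by rewrite (@lt_le_trans _ _ 0) // oppr_lt0.
  - exact: continuous_subspaceT.
  - split=> [x _||]; first exact: ex_derive.
      by apply: cvg_at_right_filter; exact: cF.
    by apply: cvg_at_left_filter; exact: cF.
  - by move=> x _; rewrite derive1E; exact: derive_val.
have [] := @dominated_convergence _ _ R mu setT measurableT g (EFin \o f)
  (abse \o (EFin \o f)).
- move=> n; apply/measurable_EFinP; apply/(measurable_restrictT f (mI n)).
  by apply: (measurable_funS measurableT) => //; apply/measurable_EFinP.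
- exact: mf.
- apply: aeW => x _; apply: cvg_near_cst; near=> n.
  rewrite /g /= patchE ifT // inE /I /= in_itv /= -ler_norml.
  rewrite (@le_trans _ _ n%:R) ?ler_nat //; near: n; exact: nbhs_infty_ger.
- exact: integrable_abse.
- apply: aeW => x n _; rewrite /g /= patchE; case: ifP => // _.
  by rewrite normr0 lee_fin normr_ge0.
move=> _ _; rewrite (_ : [sequence _]_n = fun n => (F n.+1%:R - F (- n.+1%:R))%:E).
  move=> gl; rewrite /Rintegral; apply: EFin_inj.
  rewrite fineK; last by apply: integrable_fin_num.
  apply: (@cvg_unique _ (@ereal_hausdorff R) _ _ _ _ gl).
  by apply: cvg_EFin; [exact: nearW|exact: Fl].
by apply/funext => n; exact: gE.
Unshelve. all: by end_near. Qed.

Lemma integrable_oneDsqrV : mu.-integrable setT (fun x : R => ((1 + x ^+ 2)^-1)%:E).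
Proof.
have c1 : continuous (fun x : R => (1 + x ^+ 2)^-1) by exact: continuous_oneDsqrV.
have ge1 (x : R) : 0 <= (1 + x ^+ 2)^-1 by rewrite invr_ge0 addr_ge0 // sqr_ge0.
apply/integrableP; split.
  by apply/measurable_EFinP; exact: continuous_measurable_fun.
under eq_integral do rewrite gee0_abs ?lee_fin //.
rewrite (ge0_symfun_integralT ge1 c1); last by move=> x; rewrite /= sqrrN.
by rewrite -set_itvcy integral0y_oneDsqr -EFinM ltry.
Qed.

(** [|t - (a + i b)|^2]; for [b > 0] the quotient [b / sqdist a b t] is [pi] times the Poisson
    kernel at [a + i b]. *)
Definition sqdist (a b t : R) := (t - a) ^+ 2 + b ^+ 2.

Lemma sqdist_gt0 a b t : b != 0 -> 0 < sqdist a b t.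
Proof. by move=> b0; rewrite ltr_wpDl ?sqr_ge0 // exprn_even_gt0. Qed.

Lemma is_derive_sqdist (a b t : R) : is_derive t 1 (sqdist a b) (2 * (t - a)).
Proof.
rewrite /sqdist; apply: is_derive_eq; rewrite /GRing.scale /=; ring.
Qed.

Lemma continuous_sqdist (a b : R) : continuous (sqdist a b).
Proof. exact: is_derive_continuous (is_derive_sqdist a b). Qed.

Lemma le_sqdist a b : b != 0 -> exists2 k : R, 0 < k &
  forall t, (sqdist a b t)^-1 <= k * (1 + t ^+ 2)^-1.
Proof.
move=> b0; have b2 : 0 < b ^+ 2 by rewrite exprn_even_gt0.
(* From [1 + t^2 <= 2 (t - a)^2 + (2 a^2 + 1)], where [(t - a)^2] and [b^2] are each at most
   [sqdist a b t]. *)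
exists (2 + (2 * a ^+ 2 + 1) / b ^+ 2) => [|t].
  by rewrite addr_gt0 // divr_gt0 // ltr_wpDl // mulr_ge0 // sqr_ge0.
have N0 := sqdist_gt0 a t b0.
have t0 : 0 < 1 + t ^+ 2 by rewrite ltr_wpDr // sqr_ge0.
rewrite -[leLHS]mul1r ler_pdivrMr // mulrAC ler_pdivlMr // mul1r mulrDl.
apply: (@le_trans _ _ (2 * (t - a) ^+ 2 + (2 * a ^+ 2 + 1))).
  by have := sqr_ge0 (t - 2 * a); nra.
rewrite lerD //; first by rewrite ler_pM2l // /sqdist lerDl ltW.
rewrite mulrAC ler_pdivlMr // ler_pM2l; first by rewrite /sqdist lerDr sqr_ge0.
by rewrite ltr_wpDl // mulr_ge0 // sqr_ge0.
Qed.

End RealIntegrals.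

(** * Complex-valued integrals, resolvents and their antiderivatives *)

Section ComplexIntegrals.
Variable R : realType.
Local Notation C := R[i].
Local Notation mu := (@lebesgue_measure R).
Local Notation ReC := (@complex.Re R).
Local Notation ImC := (@complex.Im R).

Definition cintegrable (g : R -> C) : Prop :=
  mu.-integrable setT (fun t => (ReC (g t))%:E) /\
  mu.-integrable setT (fun t => (ImC (g t))%:E).

Lemma complex_ReM (x y : C) : ReC (x * y) = ReC x * ReC y - ImC x * ImC y.
Proof. by case: x y => ? ? []. Qed.

Lemma complex_ImM (x y : C) : ImC (x * y) = ReC x * ImC y + ImC x * ReC y.
Proof. by case: x y => ? ? []. Qed.

Lemma integrableZ_real (f : R -> R) (k : R) :
  mu.-integrable setT (fun t => (f t)%:E) ->
  mu.-integrable setT (fun t => (k * f t)%:E).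
Proof.
move=> fi; apply: eq_integrable (integrableZl measurableT k fi) => //.
Qed.

Lemma integrableD_real (f g : R -> R) :
  mu.-integrable setT (fun t => (f t)%:E) ->
  mu.-integrable setT (fun t => (g t)%:E) ->
  mu.-integrable setT (fun t => (f t + g t)%:E).
Proof.
move=> fi gi; apply: eq_integrable (integrableD measurableT fi gi) => //.
Qed.

Lemma cintegrableD (g h : R -> C) : cintegrable g -> cintegrable h ->
  cintegrable (fun t => g t + h t).
Proof.
move=> [gr gi] [hr hi]; split; under eq_fun do rewrite raddfD /=;
exact: integrableD_real.
Qed.

Lemma complex_integralD (g h : R -> C) : cintegrable g -> cintegrable h ->
  complex_integral (fun t => g t + h t) = complex_integral g + complex_integral h.
Proof.
move=> [gr gi] [hr hi]; rewrite /complex_integral.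
under eq_Rintegral do rewrite raddfD /=.
under [X in _ +i* X]eq_Rintegral do rewrite raddfD /=.
by rewrite !RintegralD.
Qed.

Lemma cintegrableZ (k : C) (g : R -> C) : cintegrable g ->
  cintegrable (fun t => k * g t).
Proof.
move=> [gr gi]; split.
  under eq_fun do rewrite complex_ReM -mulNr.
  by apply: integrableD_real; apply: integrableZ_real.
under eq_fun do rewrite complex_ImM.
by apply: integrableD_real; apply: integrableZ_real.
Qed.

Lemma complex_integralZ (k : C) (g : R -> C) : cintegrable g ->
  complex_integral (fun t => k * g t) = k * complex_integral g.
Proof.
move=> [gr gi]; rewrite /complex_integral.
under eq_Rintegral do rewrite complex_ReM.
under [X in _ +i* X]eq_Rintegral do rewrite complex_ImM.
rewrite RintegralB ?RintegralD ?RintegralZl //; try exact: integrableZ_real.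
by case: k.
Qed.

Lemma cintegrable_sum (I : eqType) (s : seq I) (g : I -> R -> C) :
  (forall i, i \in s -> cintegrable (g i)) ->
  cintegrable (fun t => \sum_(i <- s) g i t).
Proof.
elim: s => [|i s IHs] gi.
  under eq_fun do rewrite big_nil.
  by split; under eq_fun do rewrite /=; apply: integrable0.
under eq_fun do rewrite big_cons; apply: cintegrableD.
  by apply: gi; rewrite mem_head.
by apply: IHs => j js; apply: gi; rewrite inE js orbT.
Qed.

Lemma complex_integral_sum (I : eqType) (s : seq I) (g : I -> R -> C) :
  (forall i, i \in s -> cintegrable (g i)) ->
  complex_integral (fun t => \sum_(i <- s) g i t) =
  \sum_(i <- s) complex_integral (g i).
Proof.
elim: s => [|i s IHs] gi.
  rewrite big_nil; under eq_fun do rewrite big_nil.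
  by rewrite /complex_integral /= Rintegral_cst // mul0r.
have gs j : j \in s -> cintegrable (g j).
  by move=> js; apply: gi; rewrite inE js orbT.
rewrite big_cons -IHs // -complex_integralD //; last exact: cintegrable_sum.
  by congr complex_integral; apply/funext => t; rewrite big_cons.
by apply: gi; rewrite mem_head.
Qed.

Definition rational_decay (f : R -> R) : Prop :=
  continuous f /\ exists k : R, forall t, `|f t| <= k * (1 + t ^+ 2)^-1.

Lemma rational_decay_integrable (f : R -> R) : rational_decay f ->
  mu.-integrable setT (fun t => (f t)%:E).
Proof.
move=> [fc [k fk]].
apply: (le_integrable measurableT _ _ (integrableZ_real k (@integrable_oneDsqrV R))).
  by apply/measurable_EFinP; exact: continuous_measurable_fun.
by move=> t _; rewrite lee_fin (le_trans (fk t)) // ler_norm.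
Qed.

Definition resolvent (p : C) (t : R) : C := (t%:C - p)^-1.

Lemma Re_resolvent p t :
  ReC (resolvent p t) = (t - ReC p) / sqdist (ReC p) (ImC p) t.
Proof. by case: p => a b; rewrite /resolvent /sqdist /= add0r sqrrN. Qed.

Lemma Im_resolvent p t :
  ImC (resolvent p t) = ImC p / sqdist (ReC p) (ImC p) t.
Proof.
by case: p => a b; rewrite /resolvent /sqdist /= add0r sqrrN mulNr opprK.
Qed.

Lemma norm_resolvent p t : `|resolvent p t| ^+ 2 =
  ((sqdist (ReC p) (ImC p) t)^-1)%:C.
Proof.
rewrite /resolvent normfV exprVn -add_Re2_Im2 fmorphV; congr (_%:C^-1).
by case: p => a b; rewrite /sqdist /= add0r sqrrN.
Qed.

Lemma continuous_Re_resolvent p : ImC p != 0 ->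
  continuous (fun t => ReC (resolvent p t)).
Proof.
move=> p0; under eq_fun do rewrite Re_resolvent.
move=> t; apply: cvgM; first by apply: cvgB; [exact: cvg_id|exact: cvg_cst].
apply: cvgV; last exact: continuous_sqdist.
by rewrite gt_eqF // sqdist_gt0.
Qed.

Lemma continuous_Im_resolvent p : ImC p != 0 ->
  continuous (fun t => ImC (resolvent p t)).
Proof.
move=> p0; under eq_fun do rewrite Im_resolvent.
move=> t; apply: cvgM; first exact: cvg_cst.
apply: cvgV; last exact: continuous_sqdist.
by rewrite gt_eqF // sqdist_gt0.
Qed.

Lemma cintegrable_resolvent2 p q : ImC p != 0 -> ImC q != 0 ->
  cintegrable (fun t => resolvent p t * resolvent q t).
Proof.
move=> p0 q0.
have [k k0 pk] := le_sqdist (ReC p) p0; have [l l0 ql] := le_sqdist (ReC q) q0.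
have bnd t : `|resolvent p t * resolvent q t| <= ((k + l) * (1 + t ^+ 2)^-1)%:C.
  have : `|resolvent p t * resolvent q t| <=
      `|resolvent p t| ^+ 2 + `|resolvent q t| ^+ 2.
    rewrite normrM; set x := `|_|; set y := `|_|.
    have xR : x \is Num.real by rewrite normr_real.
    have yR : y \is Num.real by rewrite normr_real.
    have xy : 0 <= (x - y) ^+ 2 by rewrite real_exprn_even_ge0 ?rpredB.
    have xy0 : 0 <= x * y by rewrite mulr_ge0 ?normr_ge0.
    rewrite -subr_ge0 (_ : _ - _ = (x - y) ^+ 2 + x * y); last by ring.
    exact: addr_ge0.
  move=> /le_trans; apply; rewrite !norm_resolvent -rmorphD lecR mulrDl.
  by apply: lerD.
split; apply: rational_decay_integrable; split.
- under eq_fun do rewrite complex_ReM; move=> t; apply: cvgB; apply: cvgM;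
  by [exact: continuous_Re_resolvent|exact: continuous_Im_resolvent].
- exists (k + l) => t; rewrite -lecR; apply: le_trans (bnd t).
  exact: normc_ge_Re.
- under eq_fun do rewrite complex_ImM; move=> t; apply: cvgD; apply: cvgM;
  by [exact: continuous_Re_resolvent|exact: continuous_Im_resolvent].
- exists (k + l) => t; rewrite -lecR; apply: le_trans (bnd t).
  exact: Im_le_norm.
Qed.

Lemma cvg_shift_invn (f : R -> R) : {for 0, continuous f} ->
  f (n.+1%:R^-1) @[n --> \oo] --> f 0.
Proof. by move=> fc; apply: continuous_cvg => //; exact: cvg_harmonic. Qed.

(** Since [sqdist a b s = s^2 * P (1/s)], the diverging [ln (s^2)] cancels between [s] and [-s], and
    [P] is continuous at 0 with [P 0 = 1]. *)
Lemma ln_sqdist_sym (a b : R) : b != 0 ->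
  ln (sqdist a b n.+1%:R) - ln (sqdist a b (- n.+1%:R)) @[n --> \oo] --> (0 : R).
Proof.
move=> b0.
pose P (u : R) := (1 - a * u) ^+ 2 + b ^+ 2 * u ^+ 2.
have P0 : P 0 = 1 by rewrite /P mulr0 subr0 expr1n expr0n mulr0 addr0.
have Pc : continuous P.
  apply: (is_derive_continuous (df := fun u => - 2 * a * (1 - a * u) + 2 * b ^+ 2 * u)).
  by move=> u; rewrite /P; apply: is_derive_eq; rewrite /GRing.scale /=; ring.
have lnP : {for 0, continuous (fun u => ln (P u) - ln (P (- u)))}.
  apply: cvgB.
    apply: continuous_comp; first exact: Pc.
    by apply: continuous_ln; rewrite P0.
  apply: (@continuous_comp _ _ _ (fun u => P (- u))).
    by apply: continuous_comp; [exact: oppr_continuous|exact: Pc].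
  by apply: continuous_ln; rewrite oppr0 P0.
have := cvg_shift_invn lnP; rewrite oppr0 subrr.
apply: cvg_trans; apply: near_eq_cvg; near=> n.
have n0 : n.+1%:R != 0 :> R by rewrite pnatr_eq0.
have n2 : 0 < n.+1%:R ^+ 2 :> R by rewrite exprn_gt0.
have lnN (s : R) : s != 0 ->
    ln (sqdist a b s) = ln (P s^-1) + ln (s ^+ 2).
  move=> s0; have s2 : 0 < s ^+ 2 by rewrite exprn_even_gt0.
  have E : sqdist a b s = P s^-1 * s ^+ 2 by rewrite /sqdist /P; field.
  have N0 := sqdist_gt0 a s b0.
  have PN : 0 < P s^-1 by rewrite -(pmulr_lgt0 _ s2) -E.
  by rewrite E lnM ?posrE.
by rewrite !lnN ?oppr_eq0 // sqrrN invrN; ring.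
Unshelve. all: by end_near. Qed.

Lemma atan_sym (a b : R) : b != 0 ->
  atan ((n.+1%:R - a) / b) - atan ((- n.+1%:R - a) / b) @[n --> \oo]
    --> pi * Num.sg b.
Proof.
have pos (c : R) : 0 < c -> forall d, 
    atan ((n.+1%:R - d) / c) @[n --> \oo] --> pi / 2.
  move=> c0 d; apply: (cvg_comp _ _ _ (@cvgy_atan R)).
  apply/cvgryPge => M; near=> n; rewrite ler_pdivlMr // lerBrDr.
  apply: (@le_trans _ _ n%:R); last by rewrite ler_nat.
  near: n; exact: nbhs_infty_ger.
have half : pi / 2 + pi / 2 = pi :> R by rewrite -splitr.
have sym (c : R) : 0 < c ->
  atan ((n.+1%:R - a) / c) - atan ((- n.+1%:R - a) / c) @[n --> \oo] --> pi.
  move=> c0; rewrite -half.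
  have -> : (fun n => atan ((n.+1%:R - a) / c) - atan ((- n.+1%:R - a) / c)) =
      (fun n => atan ((n.+1%:R - a) / c) + atan ((n.+1%:R - - a) / c)).
    by apply/funext => n /=; rewrite -[in LHS]opprD mulNr atanN !opprK.
  by apply: cvgD; exact: pos.
rewrite neq_lt => /orP[b0|b0]; last by rewrite gtr0_sg // mulr1; exact: sym.
rewrite ltr0_sg // mulrN1.
have -> : (fun n => atan ((n.+1%:R - a) / b) - atan ((- n.+1%:R - a) / b)) =
  (fun n => - (atan ((n.+1%:R - a) / - b) - atan ((- n.+1%:R - a) / - b))).
  by apply/funext => n; rewrite invrN !mulrN !atanN; ring.
by apply: cvgN; apply: sym; rewrite oppr_gt0.
Unshelve. all: by end_near. Qed.

Lemma is_derive_ln_sqdist (a b t : R) : b != 0 ->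
  is_derive t 1 (fun t => ln (sqdist a b t) / 2) ((t - a) / sqdist a b t).
Proof.
move=> b0; have N0 := sqdist_gt0 a t b0; have dN := is_derive_sqdist a b t.
have dln := is_derive1_ln N0.
have dc : is_derive t 1 (@ln R \o sqdist a b) ((sqdist a b t)^-1 * (2 * (t - a))).
  by apply: is_derive1_comp.
have dm := is_deriveM dc (is_derive_cst (2^-1 : R) t 1).
apply: (is_derive_eq dm).
rewrite /GRing.scale /=; field.
by rewrite gt_eqF.
Qed.

Lemma is_derive_atan_sqdist (a b t : R) : b != 0 ->
  is_derive t 1 (fun t => atan ((t - a) / b)) (b / sqdist a b t).
Proof.
move=> b0; have N0 := sqdist_gt0 a t b0.
have d1 : is_derive t 1 (fun t : R => (t - a) / b) b^-1.
  by apply: is_derive_eq; rewrite /GRing.scale /=; ring.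
have dc : is_derive t 1 (@atan R \o (fun t : R => (t - a) / b)) 
    ((1 + ((t - a) / b) ^+ 2)^-1 * b^-1).
  by apply: is_derive1_comp.
apply: (is_derive_eq dc).
rewrite /sqdist; field; rewrite b0 /=.
by rewrite [X in X != 0](_ : _ = sqdist a b t) ?gt_eqF // /sqdist; ring.
Qed.

End ComplexIntegrals.

(** * Integrals of products of two resolvents *)

Section Residues.
Variable R : realType.
Local Notation C := R[i].
Local Notation mu := (@lebesgue_measure R).
Local Notation ReC := (@complex.Re R).
Local Notation ImC := (@complex.Im R).
Implicit Types p q : C.

Lemma cvgn_ext (f g : nat -> R) (l : R) :
  f @ \oo --> l -> f =1 g -> g @ \oo --> l.
Proof. by move=> fl /funext <-. Qed.

Lemma cvgnB (f g : nat -> R) (a b : R) :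
  f @ \oo --> a -> g @ \oo --> b -> f n - g n @[n --> \oo] --> a - b.
Proof. exact: cvgB. Qed.

Lemma cvgnM (c : R) (f : nat -> R) (a : R) :
  f @ \oo --> a -> f n * c @[n --> \oo] --> a * c.
Proof. exact: cvgMr_tmp. Qed.

Lemma real_sub_neq0 (t : R) p : ImC p != 0 -> t%:C - p != 0.
Proof.
by case: p => a b /=; apply: contra_neq => -[_ /eqP]; rewrite sub0r oppr_eq0 => /eqP.
Qed.

(** The symmetric limit of the integral of one resolvent is [i pi sg (Im p)]; the antiderivatives
    are the logarithm of the distance for the real part and the arctangent for the imaginary
    part. *)
Lemma complex_integral_resolventB p q : ImC p != 0 -> ImC q != 0 ->
  cintegrable (fun t => resolvent p t - resolvent q t) ->
  complex_integral (fun t => resolvent p t - resolvent q t) =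
  0 +i* (pi * (Num.sg (ImC p) - Num.sg (ImC q))).
Proof.
move=> p0 q0 [hr hi]; rewrite /complex_integral; congr (_ +i* _).
  apply: (@integral_antiderivative R _ (fun t =>
    ln (sqdist (ReC p) (ImC p) t) / 2 - ln (sqdist (ReC q) (ImC q) t) / 2)).
  - exact: hr.
  - move=> t; under eq_fun do rewrite raddfB /=.
    by apply: cvgB; exact: continuous_Re_resolvent.
  - move=> t; rewrite raddfB /= !Re_resolvent.
    by apply: is_deriveB; exact: is_derive_ln_sqdist.
  - have := cvgnM (c := 2^-1)
      (cvgnB (ln_sqdist_sym (ReC p) p0) (ln_sqdist_sym (ReC q) q0)).
    rewrite subr0 mul0r.
    by move=> L; apply: (cvgn_ext L) => n /=; ring.
apply: (@integral_antiderivative R _ (fun t =>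
  atan ((t - ReC p) / ImC p) - atan ((t - ReC q) / ImC q))).
- exact: hi.
- move=> t; under eq_fun do rewrite raddfB /=.
  by apply: cvgB; exact: continuous_Im_resolvent.
- move=> t; rewrite raddfB /= !Im_resolvent.
  by apply: is_deriveB; exact: is_derive_atan_sqdist.
- rewrite mulrBr; have := cvgnB (atan_sym (ReC p) p0) (atan_sym (ReC q) q0).
  by move=> L; apply: (cvgn_ext L) => n /=; ring.
Qed.

Lemma complex_integral_resolvent2 p q : ImC p != 0 -> ImC q != 0 -> p != q ->
  complex_integral (fun t => resolvent p t * resolvent q t) =
  'i%C * (pi * (Num.sg (ImC p) - Num.sg (ImC q)))%:C / (p - q).
Proof.
move=> p0 q0 pq; have pqi := cintegrable_resolvent2 p0 q0.
have hE : (fun t => resolvent p t - resolvent q t) =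
    (fun t => (p - q) * (resolvent p t * resolvent q t)).
  apply/funext => t; rewrite /resolvent.
  have tp := real_sub_neq0 t p0; have tq := real_sub_neq0 t q0.
  by field; rewrite tp tq.
have hi : cintegrable (fun t => resolvent p t - resolvent q t).
  by rewrite hE; exact: cintegrableZ.
have := complex_integral_resolventB p0 q0 hi; rewrite hE complex_integralZ //.
have pq0 : p - q != 0 by rewrite subr_eq0.
move=> E; apply: (mulfI pq0); rewrite E [RHS]mulrC divfK //.
by rewrite [LHS]complexE /= add0r.
Qed.

(** The double pole, where division by [p - q] is impossible: the real part of [- resolvent p] is an
    antiderivative that vanishes at infinity. It serves the Poisson semigroup at coinciding
    points. *)
Lemma Re_complex_integral_resolventX2 p : ImC p != 0 ->
  ReC (complex_integral (fun t => resolvent p t * resolvent p t)) = 0.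
Proof.
move=> p0; have [pi_ _] := cintegrable_resolvent2 p0 p0.
rewrite /complex_integral /=.
set a := ReC p; set b := ImC p.
apply: (@integral_antiderivative R _ (fun t => - ((t - a) / sqdist a b t))).
- exact: pi_.
- move=> t; under eq_fun do rewrite complex_ReM.
  by apply: cvgB; apply: cvgM;
    by [exact: continuous_Re_resolvent|exact: continuous_Im_resolvent].
- move=> t; have N0 := sqdist_gt0 a t p0; have dN := is_derive_sqdist a b t.
  have N0' : sqdist a b t != 0 by rewrite gt_eqF.
  have dV := is_deriveV N0' dN.
  have dM := is_deriveN (is_deriveM
    (is_deriveB (is_derive_id t 1) (is_derive_cst a t 1)) dV).
  apply: (is_derive_eq dM); rewrite complex_ReM Re_resolvent Im_resolvent -/a -/b.
  rewrite /GRing.scale /=; move: N0'; rewrite /sqdist => N0'.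
  rewrite -[(id - cst a) t]/(t - a); field.
  by rewrite [X in X != 0](_ : _ = (t - a) ^+ 2 + b ^+ 2) //; ring.
- pose P (u : R) := (1 - a * u) ^+ 2 + b ^+ 2 * u ^+ 2.
  pose Q (u : R) := u * (1 - a * u) / P u.
  have dP (u : R) : is_derive u 1 P (- 2 * a * (1 - a * u) + 2 * b ^+ 2 * u).
    by rewrite /P; apply: is_derive_eq; rewrite /GRing.scale /=; ring.
  have Qc : {for 0, continuous Q}.
    apply: cvgM; last first.
      apply: cvgV; last exact: (is_derive_continuous dP).
      by rewrite /P mulr0 subr0 expr1n expr0n mulr0 addr0 oner_neq0.
    apply: cvgM; first exact: cvg_id.
    apply: cvgB; first exact: cvg_cst.
    by apply: cvgM; [exact: cvg_cst|exact: cvg_id].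
  have Qs : {for 0, continuous (fun u => Q (- u) - Q u)}.
    apply: cvgB => //; apply: (@continuous_comp _ _ _ -%R Q).
      exact: oppr_continuous.
    by rewrite oppr0.
  have := cvg_shift_invn Qs; rewrite oppr0 subrr.
  move=> L; apply: (cvgn_ext L) => n /=.
  have QE (s : R) : s != 0 -> Q s^-1 = (s - a) / sqdist a b s.
    move=> s0; have := sqdist_gt0 a s p0; rewrite -/b /Q /P /sqdist => /lt0r_neq0 N0.
    by field; rewrite s0 andbT; exact: N0.
  by rewrite -invrN !QE ?oppr_eq0 ?pnatr_eq0 //; ring.
Qed.

Lemma rational_decay_sqdistV (a b : R) : b != 0 ->
  rational_decay (fun t => (sqdist a b t)^-1).
Proof.
move=> b0; split.
  move=> t; apply: cvgV; last exact: continuous_sqdist.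
  by rewrite gt_eqF // sqdist_gt0.
have [k _ ak] := le_sqdist a b0; exists k => t.
by rewrite ger0_norm // invr_ge0 ltW // sqdist_gt0.
Qed.

Lemma Rintegral_sqdistV (a b : R) : 0 < b ->
  \int[mu]_t (b / sqdist a b t) = pi.
Proof.
move=> b0; have bN0 := lt0r_neq0 b0.
apply: (@integral_antiderivative R _ (fun t => atan ((t - a) / b))).
- exact: integrableZ_real (rational_decay_integrable (rational_decay_sqdistV a bN0)).
- move=> t; apply: cvgM; first exact: cvg_cst.
  by case: (rational_decay_sqdistV a bN0) => + _; apply.
- by move=> t; exact: is_derive_atan_sqdist.
- by have := atan_sym a bN0; rewrite gtr0_sg // mulr1.
Qed.

Lemma resolvent_conj p t : conjc (resolvent p t) = resolvent (conjc p) t.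
Proof.
rewrite /resolvent conjc_inv; congr (_^-1).
by case: p => a b /=; congr (_ +i* _); ring.
Qed.

(* The semigroup property of the Poisson kernel, from
   [2 Im A Im B = Re (A conj B) - Re (A B)] with resolvents [A], [B]. *)
Lemma Rintegral_Poisson2 (a b c d : R) : 0 < b -> 0 < d ->
  \int[mu]_t (b / sqdist a b t * (d / sqdist c d t)) =
  pi * (b + d) / sqdist a (b + d) c.
Proof.
move=> b0 d0; pose p := a +i* b; pose q := c +i* d.
have p0 : ImC p != 0 by rewrite gt_eqF.
have q0 : ImC q != 0 by rewrite gt_eqF.
have q0' : ImC (conjc q) != 0 by rewrite oppr_eq0.
have pq' : p != conjc q.
  by apply/eqP => -[_ bd]; have := addr_gt0 b0 d0; rewrite bd addNr ltxx.
have ImIm t : b / sqdist a b t * (d / sqdist c d t) =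
    2^-1 * ReC (resolvent p t * resolvent (conjc q) t)
    - 2^-1 * ReC (resolvent p t * resolvent q t).
  rewrite -resolvent_conj !complex_ReM -(Im_resolvent p t) -(Im_resolvent q t).
  by case: (resolvent p t) (resolvent q t) => ? ? [? ?] /=; field.
have [i1 _] := cintegrable_resolvent2 p0 q0'.
have [i2 _] := cintegrable_resolvent2 p0 q0.
under eq_Rintegral do rewrite ImIm.
rewrite RintegralB //; try exact: integrableZ_real.
rewrite !RintegralZl //.
(* Both poles lie above the real axis, so their signs cancel; for [p = q] the double pole formula
   takes over. *)
have -> : \int[mu]_t ReC (resolvent p t * resolvent q t) = 0.
  have [->|pq] := eqVneq p q; first exact: Re_complex_integral_resolventX2.
  have := complex_integral_resolvent2 p0 q0 pq.
  by rewrite !gtr0_sg // subrr mulr0 mulr0 mul0r => /(congr1 ReC).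
have := complex_integral_resolvent2 p0 q0' pq'.
move=> /(congr1 ReC); rewrite [LHS]/= => ->.
rewrite gtr0_sg // ltr0_sg; last by rewrite oppr_lt0.
have N0 : sqdist a (b + d) c != 0 by rewrite gt_eqF // sqdist_gt0 // gt_eqF ?addr_gt0.
move: N0; rewrite mulr0 subr0 /sqdist /= => N0.
by field; rewrite [X in X != 0](_ : _ = (c - a) ^+ 2 + (b + d) ^+ 2) //; ring.
Qed.

End Residues.

(** * Poisson integrals of logarithms *)

Section LogPoisson.
Variable R : realType.
Local Notation mu := (@lebesgue_measure R).

Lemma measurable_invr_ge0 d (T : measurableType d) (D : set T) (f : T -> R) :
  (forall t, 0 <= f t) -> measurable_fun D f -> measurable_fun D (fun t => (f t)^-1).
Proof.
move=> f0 mf; under eq_fun do rewrite -powR_inv1 //.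
exact: (measurableT_comp (measurable_powR (-1)) mf).
Qed.

(** [G] is a primitive in [v] of the nonnegative kernel [k], and Tonelli exchanges the integrals in
    [t] and [v]. The point [a] is exempt because the inner integral may diverge there:
    [v / sqdist a v t] equals [1 / v] at [t = a]. *)
Lemma tonelli_antiderivative (U a : R) (q : R -> R) (k : R -> R -> R)
    (G h : R -> R) (H : R) :
  (forall t, 0 <= q t) -> measurable_fun [set: R] q ->
  measurable_fun [set: R * R] (fun z => k z.1 z.2) ->
  (forall t v, 0 < v -> 0 <= k t v) -> measurable_fun [set: R] G ->
  (forall t, t != a -> (\int[mu]_(v in `]0%R, U[) (k t v)%:E = (G t)%:E)%E) ->
  (forall v, 0 < v -> (\int[mu]_t (q t * k t v)%:E = (h v)%:E)%E) ->
  (\int[mu]_(v in `]0%R, U[) (h v)%:E = H%:E)%E ->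
  (\int[mu]_t (q t * G t)%:E = H%:E)%E.
Proof.
move=> q0 mq mk k0 mG kG qk hH.
pose D : set R := `]0, U[%classic.
have mD : measurable D by exact: measurable_itv.
pose f (z : R * R) : \bar R := (q z.1 * k z.1 z.2 * \1_D z.2)%:E.
have mf : measurable_fun [set: R * R] f.
  apply/measurable_EFinP; apply: measurable_funM.
    by apply: measurable_funM => //; exact: measurableT_comp mq measurable_fst.
  exact: measurableT_comp (measurable_indic mD) measurable_snd.
have f0 z : (0 <= f z)%E.
  rewrite lee_fin indicE; case: (boolP (z.2 \in D)); last by rewrite mulr0.
  rewrite inE /D /= in_itv /= => /andP[z0 _].
  by rewrite mulr1 mulr_ge0 // k0.
have fD (g : R -> R) (v : R) : ((g v * \1_D v)%:E = ((EFin \o g) \_ D) v)%E.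
  by rewrite patchE indicE; case: ifP => _; rewrite ?mulr1 ?mulr0.
have mkt t : measurable_fun [set: R] (k t).
  exact: measurableT_comp mk (pair1_measurable t).
transitivity (\int[mu]_t \int[mu]_v f (t, v))%E.
  apply: ae_eq_integral => //.
  - by apply/measurable_EFinP; exact: measurable_funM.
  - exact: measurable_fun_fubini_tonelli_F.
  - exists [set a]; split => //; first exact: lebesgue_measure_set1.
    move=> t /= /not_implyP[_ ta]; apply: contrapT => /eqP /kG kt; apply: ta.
    under eq_integral do rewrite /f /= (fD (fun v => q t * k t v)).
    rewrite -integral_mkcond; under eq_integral do rewrite /= EFinM.
    rewrite ge0_integralZl_EFin ?kt //.
    + by move=> v; rewrite /D /= in_itv /= => /andP[v0 _]; rewrite lee_fin k0.
    + apply/measurable_EFinP; exact: (measurable_funS measurableT (@subsetT _ _) (mkt t)).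
rewrite fubini_tonelli // -hH [RHS]integral_mkcond; apply: eq_integral => v _.
rewrite patchE; case: ifPn => [|/negPf vD]; last first.
  by apply: integral0_eq => t _; rewrite /f /= indicE vD mulr0.
rewrite inE /D /= in_itv /= => vD; case/andP: (vD) => v0 _.
rewrite -qk //; apply: eq_integral => t _; rewrite /f /= indicE.
by rewrite mem_set ?mulr1 //= in_itv.
Qed.

Lemma integral_half_ln_derive (P dP : R -> R) (U : R) : 0 < U ->
  (forall v : R, is_derive v 1 P (dP v)) -> continuous dP ->
  (forall v, 0 <= v -> 0 < P v) ->
  (\int[mu]_(v in `]0%R, U[) (dP v / (2 * P v))%:E =
   (ln (P U) / 2 - ln (P 0) / 2)%:E)%E.
Proof.
move=> U0 dPE dPc P0; have Pc := is_derive_continuous dPE.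
have dl (v : R) : 0 <= v -> is_derive v 1 (fun v => ln (P v) / 2) (dP v / (2 * P v)).
  move=> v0; have Pv := P0 v v0; have dln := is_derive1_ln Pv.
  have dc : is_derive v 1 (@ln R \o P) ((P v)^-1 * dP v).
    by apply: is_derive1_comp.
  have dm := is_deriveM dc (is_derive_cst (2^-1 : R) v 1).
  apply: (is_derive_eq dm); rewrite /GRing.scale /=; field.
  by rewrite gt_eqF.
have c (v : R) : 0 <= v -> {for v, continuous (fun v => dP v / (2 * P v))}.
  move=> v0; apply: cvgM; first exact: dPc.
  apply: cvgV; first by rewrite gt_eqF // mulr_gt0 // P0.
  by apply: cvgM; [exact: cvg_cst|exact: Pc].
have cF (v : R) : 0 <= v -> {for v, continuous (fun v => ln (P v) / 2)}.
  move=> v0; apply: differentiable_continuous; apply/derivable1_diffP.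
  by have dv := dl v v0; exact: ex_derive.
have ctn : {within `[0, U], continuous (fun v => dP v / (2 * P v))}.
  by apply: continuous_in_subspaceT => v; rewrite inE /= in_itv /= => /andP[/c].
rewrite -(@integral_itv_bndoo _ _ _ _ true false); last first.
  apply/measurable_EFinP; apply: (@measurable_funS _ _ _ _ `[0, U]) => //.
    by apply: subset_itv_oo_cc.
  exact: subspace_continuous_measurable_fun.
rewrite (@continuous_FTC2 _ _ (fun v => ln (P v) / 2)) //.
- split => [v|| ].
  + by rewrite in_itv /= => /andP[/ltW /dl ? _]; exact: ex_derive.
  + by apply: cvg_at_right_filter; apply: cF.
  + by apply: cvg_at_left_filter; apply: cF; exact: ltW.
- by move=> v; rewrite in_itv /= => /andP[/ltW /dl ? _]; rewrite derive1E; exact: derive_val.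
Qed.

End LogPoisson.

Section LogPoisson2.
Variable R : realType.
Local Notation mu := (@lebesgue_measure R).

Lemma integral_fine (f : R -> R) : mu.-integrable setT (fun t => (f t)%:E) ->
  (\int[mu]_t (f t)%:E)%E = (\int[mu]_t f t)%:E.
Proof. by move=> fi; rewrite /Rintegral fineK //; apply: integrable_fin_num. Qed.

Lemma ge0_integrable_Rintegral (f : R -> R) (l : R) : measurable_fun [set: R] f ->
  (forall t, 0 <= f t) -> (\int[mu]_t (f t)%:E = l%:E)%E ->
  mu.-integrable setT (fun t => (f t)%:E) /\ \int[mu]_t f t = l.
Proof.
move=> mf f0 fl; split; last by rewrite /Rintegral fl.
apply/integrableP; split; first exact/measurable_EFinP.
by under eq_integral do rewrite gee0_abs ?lee_fin //; rewrite fl ltry.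
Qed.

Lemma rational_decayM (f g : R -> R) : rational_decay f -> rational_decay g ->
  rational_decay (fun t => f t * g t).
Proof.
move=> [fc [k fk]] [gc [l gl]]; split.
  by move=> t; apply: cvgM; [exact: fc|exact: gc].
exists (k * l) => t; rewrite normrM.
have t1 : (1 + t ^+ 2)^-1 <= 1 by exact: oneDsqrV_le1.
have t0 : 0 < (1 + t ^+ 2)^-1 by rewrite invr_gt0 ltr_wpDr // sqr_ge0.
have k0 : 0 <= k by rewrite -(pmulr_lge0 _ t0) (le_trans _ (fk t)).
have l0 : 0 <= l by rewrite -(pmulr_lge0 _ t0) (le_trans _ (gl t)).
apply: (le_trans (ler_pM (normr_ge0 _) (normr_ge0 _) (fk t) (gl t))).
rewrite mulrACA ler_wpM2l ?mulr_ge0 // ler_piMl // ltW //.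
Qed.

Lemma integral_half_ln_scaled (P dP : R -> R) (c U : R) : 0 < U ->
  (forall v : R, is_derive v 1 P (dP v)) -> continuous dP ->
  (forall v, 0 <= v -> 0 < P v) -> (forall v, 0 <= v -> 0 <= dP v) -> 0 <= c ->
  (\int[mu]_(v in `]0%R, U[) (c * (dP v / (2 * P v)))%:E =
   (c * (ln (P U) / 2 - ln (P 0) / 2))%:E)%E.
Proof.
move=> U0 dPE dPc P0 dP0 c0; rewrite EFinM -(integral_half_ln_derive U0 dPE) //.
under eq_integral do rewrite EFinM.
rewrite ge0_integralZl_EFin // => [v|].
  rewrite /= in_itv /= => /andP[/ltW v0 _].
  by rewrite lee_fin divr_ge0 ?dP0 // mulr_ge0 // ltW // P0.
have Pc := is_derive_continuous dPE.
apply/measurable_EFinP; apply: open_continuous_measurable_fun => // v.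
rewrite inE /= in_itv /= => /andP[/ltW v0 _]; apply: cvgM; first exact: dPc.
apply: cvgV; first by rewrite gt_eqF // mulr_gt0 // P0.
by apply: cvgM; [exact: cvg_cst|exact: Pc].
Qed.

Section Fixed.
Variables (x y : R).
Hypothesis y0 : 0 < y.
Let yN0 : y != 0. Proof. exact: lt0r_neq0. Qed.
Let q (t : R) := (sqdist x y t)^-1.

Let q0 t : 0 <= q t. Proof. by rewrite invr_ge0 ltW // sqdist_gt0. Qed.

Let qd : rational_decay q. Proof. exact: rational_decay_sqdistV. Qed.

Let mq : measurable_fun [set: R] q.
Proof. by case: qd => qc _; exact: continuous_measurable_fun. Qed.

Let qi : mu.-integrable setT (fun t => (q t)%:E).
Proof. exact: rational_decay_integrable. Qed.

Let int_q : \int[mu]_t q t = pi / y.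
Proof.
have := Rintegral_sqdistV x y0; rewrite RintegralZl // => <-.
by rewrite [RHS]mulrC mulrA mulVf // mul1r.
Qed.

Let qPi (a v : R) : 0 < v ->
  mu.-integrable setT (fun t => (q t * (v / sqdist a v t))%:E).
Proof.
move=> v0; under eq_fun do rewrite mulrCA; apply: integrableZ_real.
apply: rational_decay_integrable; apply: rational_decayM => //.
by apply: rational_decay_sqdistV; exact: lt0r_neq0.
Qed.

Let int_qP (a v : R) : 0 < v -> \int[mu]_t (q t * (v / sqdist a v t)) =
  pi / y * ((y + v) / sqdist x (y + v) a).
Proof.
move=> v0; have := Rintegral_Poisson2 x a y0 v0.
under eq_Rintegral do rewrite -mulrA.
rewrite RintegralZl //; last exact: qPi.
move=> E; apply: (mulfI yN0); rewrite E; field.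
by rewrite yN0 gt_eqF // sqdist_gt0 // gt_eqF ?addr_gt0.
Qed.

Let measurable_quad (a : R) : measurable_fun [set: R] (fun t : R => (t - a) ^+ 2).
Proof. by apply: measurable_funX; apply: measurable_funB. Qed.

Let measurable_qln (f : R -> R) : 
  measurable_fun [set: R] f -> measurable_fun [set: R] (fun t => ln (f t) / 2).
Proof.
by move=> mf; apply: measurable_funM => //; apply: measurableT_comp mf; exact: measurable_ln.
Qed.

(** The logarithm vanishes for the dilation parameter [v = 0], and its derivative in [v] is [1/v]
    minus [1/v^2] times the kernel at height [1/v], whose integral against [q] is given by the
    semigroup property. *)
Lemma log_poisson_dilation (a U : R) : 0 < U ->
  (\int[mu]_t (q t * (ln (1 + U ^+ 2 * (t - a) ^+ 2) / 2))%:E =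
    (pi / y * (ln ((x - a) ^+ 2 * U ^+ 2 + (1 + y * U) ^+ 2) / 2))%:E)%E.
Proof.
move=> U0.
pose P (t v : R) := 1 + v ^+ 2 * (t - a) ^+ 2.
pose dP (t v : R) := 2 * v * (t - a) ^+ 2.
(* For [v != 0] this is [v^2 * sqdist a (y + 1/v) x], written so as to make sense at [v = 0]. *)
pose Q (v : R) := (x - a) ^+ 2 * v ^+ 2 + (1 + y * v) ^+ 2.
pose dQ (v : R) := 2 * (x - a) ^+ 2 * v + 2 * y * (1 + y * v).
have P0 t v : 0 < P t v by rewrite ltr_wpDr // mulr_ge0 // sqr_ge0.
have Q0 v : 0 <= v -> 0 < Q v.
  move=> v0; apply: ltr_wpDl; first by rewrite mulr_ge0 ?sqr_ge0.
  by apply: exprn_gt0; apply: ltr_wpDr; rewrite ?mulr_ge0 // ltW.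
apply: (@tonelli_antiderivative R U a q (fun t v => dP t v / (2 * P t v))
  (fun t => ln (P t U) / 2) (fun v => pi / y * (dQ v / (2 * Q v)))) => //.
- apply: measurable_funM.
    apply: measurable_funM; first exact: measurable_funM.
    exact: (measurableT_comp (measurable_quad a) measurable_fst).
  apply: measurable_invr_ge0 => [z|]; first by rewrite mulr_ge0 // ltW.
  apply: measurable_funM => //; apply: measurable_funD => //.
  apply: measurable_funM; first by apply: measurable_funX; exact: measurable_snd.
  exact: (measurableT_comp (measurable_quad a) measurable_fst).
- move=> t v /ltW v0; rewrite divr_ge0 // /dP; last by rewrite mulr_ge0 // ltW.
  by rewrite mulr_ge0 ?sqr_ge0 // mulr_ge0.
- apply: measurable_qln; rewrite /P; apply: measurable_funD => //.
  by apply: measurable_funM => //; exact: measurable_quad.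
- move=> t _; have dPE (v : R) : is_derive v 1 (P t) (dP t v).
    by rewrite /P /dP; apply: is_derive_eq; rewrite /GRing.scale /=; ring.
  rewrite (integral_half_ln_derive U0 dPE) //.
  + by rewrite {2}/P expr0n mul0r addr0 ln1 mul0r subr0.
  + apply: (@is_derive_continuous R _ (fun=> 2 * (t - a) ^+ 2)) => v.
    by rewrite /dP; apply: is_derive_eq; rewrite /GRing.scale /=; ring.
- move=> v v0; have vN0 := lt0r_neq0 v0.
  have w0 : 0 < v^-1 by rewrite invr_gt0.
  have E t : q t * (dP t v / (2 * P t v)) =
      v^-1 * q t - v^-1 ^+ 2 * (q t * (v^-1 / sqdist a v^-1 t)).
    have := P0 t v; have := sqdist_gt0 a t (lt0r_neq0 w0).
    rewrite /dP /P /sqdist => /lt0r_neq0 N0 /lt0r_neq0 N1; field.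
    by rewrite vN0 /= [X in X != 0](_ : _ = 1 + v ^+ 2 * (t - a) ^+ 2) //; ring.
  have i1 := integrableZ_real v^-1 qi.
  have i2 := integrableZ_real (v^-1 ^+ 2) (qPi a w0).
  under eq_integral do rewrite E.
  rewrite integral_fine; last first.
    have := integrableD_real i1 (integrableZ_real (-1) i2).
    by under eq_fun do rewrite mulN1r.
  congr (_%:E); rewrite RintegralB // !RintegralZl //; last exact: qPi.
  rewrite int_q int_qP //.
  have := Q0 v (ltW v0); rewrite /Q /dQ => /lt0r_neq0 N1.
  have yv : y + v^-1 != 0 by rewrite gt_eqF // addr_gt0.
  have := sqdist_gt0 x a yv; rewrite /sqdist => /lt0r_neq0 N0.
  field; rewrite yN0 vN0 /=.
  by rewrite andbT exprMn.
- have dQE (v : R) : is_derive v 1 Q (dQ v).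
    by rewrite /Q /dQ; apply: is_derive_eq; rewrite /GRing.scale /=; ring.
  rewrite (integral_half_ln_scaled U0 dQE) //.
  + by rewrite {2}/Q mulr0 addr0 expr1n expr0n /= mulr0 add0r ln1 mul0r subr0.
  + apply: (@is_derive_continuous R _ (fun=> 2 * (x - a) ^+ 2 + 2 * y * y)) => v.
    by rewrite /dQ; apply: is_derive_eq; rewrite /GRing.scale /=; ring.
  + move=> v v0; have yv : 0 <= y * v by rewrite mulr_ge0 // ltW.
    apply: addr_ge0; apply: mulr_ge0 => //; first by rewrite mulr_ge0 ?sqr_ge0.
      by rewrite mulr_ge0 // ltW.
    exact: addr_ge0.
  + by rewrite divr_ge0 ?pi_ge0 // ltW.
Qed.

(** A logarithmic singularity on the real axis is reached by lowering it from height 1: the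
    derivative of [ln (sqdist a v t) / 2] in the height [v] is the nonnegative kernel
    [v / sqdist a v t]. *)
Lemma log_poisson_translation (a : R) :
  (\int[mu]_t (q t * (ln (sqdist a 1 t) / 2 - ln (sqdist a 0 t) / 2))%:E =
    (pi / y * (ln (sqdist a (y + 1) x) / 2 - ln (sqdist a y x) / 2))%:E)%E.
Proof.
pose dP (t v : R) : R := 2 * v.
pose Q (v : R) := (x - a) ^+ 2 + (y + v) ^+ 2.
pose dQ (v : R) := 2 * (y + v).
have Q0 v : 0 <= v -> 0 < Q v.
  move=> v0; apply: ltr_wpDl; first exact: sqr_ge0.
  by apply: exprn_gt0; apply: ltr_wpDr.
apply: (@tonelli_antiderivative R 1 a q (fun t v => v / sqdist a v t)
  _ (fun v => pi / y * (dQ v / (2 * Q v)))) => //.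
- apply: measurable_funM; first exact: measurable_snd.
  apply: measurable_invr_ge0 => [z|]; first by rewrite addr_ge0 ?sqr_ge0.
  apply: measurable_funD.
    exact: (measurableT_comp (measurable_quad a) measurable_fst).
  by apply: measurable_funX; exact: measurable_snd.
- by move=> t v /ltW v0; rewrite divr_ge0 // addr_ge0 ?sqr_ge0.
- apply: measurable_funB; apply: measurable_qln;
  by apply: continuous_measurable_fun; exact: continuous_sqdist.
- move=> t ta; have dPE (v : R) : is_derive v 1 (fun v => sqdist a v t) (dP t v).
    by rewrite /sqdist /dP; apply: is_derive_eq; rewrite /GRing.scale /=; ring.
  rewrite -(integral_half_ln_derive ltr01 dPE) //; last 2 first.
  + apply: (@is_derive_continuous R _ (fun=> 2)) => v.
    by rewrite /dP; apply: is_derive_eq; rewrite /GRing.scale /=; ring.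
  + move=> v v0; apply: ltr_pwDl; last exact: sqr_ge0.
    by rewrite exprn_even_gt0 //= subr_eq0.
  apply: eq_integral => v _; congr (_%:E); rewrite /dP.
  by rewrite invfM mulrACA divff ?mul1r // pnatr_eq0.
- move=> v v0; rewrite integral_fine; last exact: qPi.
  rewrite int_qP // /dQ /Q; congr (_ * _)%:E.
  rewrite invfM mulrACA divff ?mul1r ?pnatr_eq0 // /sqdist.
  by rewrite -(sqrrN (a - x)) opprB.
- have dQE (v : R) : is_derive v 1 Q (dQ v).
    by rewrite /Q /dQ; apply: is_derive_eq; rewrite /GRing.scale /=; ring.
  rewrite (integral_half_ln_scaled ltr01 dQE) //.
  + by rewrite /Q addr0.
  + apply: (@is_derive_continuous R _ (fun=> 2)) => v.
    by rewrite /dQ; apply: is_derive_eq; rewrite /GRing.scale /=; ring.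
  + by move=> v v0; rewrite /dQ mulr_ge0 // addr_ge0 // ltW.
  + by rewrite divr_ge0 ?pi_ge0 // ltW.
Qed.

(** [log |z - (a - i b)|] is harmonic in the upper half-plane, and the right-hand side is its value
    at [x + i y] times [pi / y]. The case [b > 0] is the dilation formula rescaled by [b], the case
    [b = 0] subtracts the translation formula from the case [b = 1]. *)
Lemma log_poisson (a b : R) : 0 <= b ->
  mu.-integrable setT (fun t => (q t * (ln (sqdist a b t) / 2))%:E) /\
  \int[mu]_t (q t * (ln (sqdist a b t) / 2)) = pi / y * (ln (sqdist a (y + b) x) / 2).
Proof.
have pos c : 0 < c ->
    mu.-integrable setT (fun t => (q t * (ln (sqdist a c t) / 2))%:E) /\
    \int[mu]_t (q t * (ln (sqdist a c t) / 2)) =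
    pi / y * (ln (sqdist a (y + c) x) / 2).
  move=> c0; have cN0 := lt0r_neq0 c0.
  have c'0 : 0 < c^-1 by rewrite invr_gt0.
  pose g t := q t * (ln (1 + c^-1 ^+ 2 * (t - a) ^+ 2) / 2).
  have ge1 t : 1 <= 1 + c^-1 ^+ 2 * (t - a) ^+ 2.
    by rewrite lerDl mulr_ge0 ?sqr_ge0.
  have [||gi gI] := ge0_integrable_Rintegral _ _ (log_poisson_dilation a c'0).
  - apply: measurable_funM => //; apply: measurable_qln; apply: measurable_funD => //.
    by apply: measurable_funM => //; exact: measurable_quad.
  - by move=> t; rewrite mulr_ge0 // divr_ge0 // ln_ge0.
  have E t : q t * (ln (sqdist a c t) / 2) = g t + ln c * q t.
    have -> : sqdist a c t = (1 + c^-1 ^+ 2 * (t - a) ^+ 2) * c ^+ 2.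
      by rewrite /sqdist; field.
    rewrite lnM ?posrE ?exprn_gt0 // ?(lt_le_trans ltr01) // lnXn // /g.
    by rewrite -[ln c *+ 2]mulr_natr; field.
  have ci := integrableZ_real (ln c) qi.
  split; first by under eq_fun do rewrite E; exact: integrableD_real.
  under eq_Rintegral do rewrite E.
  rewrite RintegralD // RintegralZl // gI int_q.
  have -> : sqdist a (y + c) x = ((x - a) ^+ 2 * c^-1 ^+ 2 + (1 + y * c^-1) ^+ 2) * c ^+ 2.
    by rewrite /sqdist; field.
  rewrite lnM ?posrE ?exprn_gt0 // ?lnXn //; last first.
    apply: ltr_wpDl; first by rewrite mulr_ge0 ?sqr_ge0.
    by apply: exprn_gt0; apply: ltr_wpDr => //; rewrite divr_ge0 // ltW.
  by rewrite -[ln c *+ 2]mulr_natr; field.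
rewrite le_eqVlt => /predU1P[<-|]; last exact: pos.
have [i1 I1] := pos 1 ltr01; rewrite addr0.
have [||gi gI] := ge0_integrable_Rintegral _ _ (log_poisson_translation a).
- apply: measurable_funM => //.
  apply: measurable_funB; apply: measurable_qln;
  by apply: continuous_measurable_fun; exact: continuous_sqdist.
- move=> t; rewrite mulr_ge0 // subr_ge0 ler_pM2r ?invr_gt0 //.
  (* At [t = a] the convention [ln 0 = 0] turns the difference into [0 - 0]. *)
  have [->|ta] := eqVneq t a.
    by rewrite /sqdist subrr expr0n /= addr0 add0r expr1n ln1 ln0.
  have t0 : 0 < (t - a) ^+ 2 by rewrite exprn_even_gt0 //= subr_eq0.
  rewrite ler_ln ?posrE /sqdist ?expr0n ?addr0 ?lerDl ?expr1n // ltr_pwDl //.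
have E t : q t * (ln (sqdist a 0 t) / 2) = q t * (ln (sqdist a 1 t) / 2)
   - q t * (ln (sqdist a 1 t) / 2 - ln (sqdist a 0 t) / 2) by ring.
split.
  under eq_fun do rewrite E -[X in _ + X]mulN1r.
  by apply: integrableD_real => //; exact: integrableZ_real.
under eq_Rintegral do rewrite E.
by rewrite RintegralB // I1 gI; ring.
Qed.

End Fixed.
End LogPoisson2.

(** * Rational functions with poles in the lower half-plane *)

Section Rational.
Variable R : realType.
Local Notation C := R[i].
Local Notation mu := (@lebesgue_measure R).
Local Notation ReC := (@complex.Re R).
Local Notation ImC := (@complex.Im R).
Local Notation normc := ComplexField.Normc.normc.
Implicit Types (s : seq (C * C)) (z a : C).

Definition partial_fraction s z : C := \sum_(p <- s) p.1 * (z - p.2)^-1.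

Definition lower_poles s := forall p, p \in s -> ImC p.2 < 0.

Lemma lower_poles_cons p s : lower_poles (p :: s) -> ImC p.2 < 0 /\ lower_poles s.
Proof.
move=> sl; split; first by apply: sl; rewrite mem_head.
by move=> q qs; apply: sl; rewrite inE qs orbT.
Qed.

Lemma Im_ge0_sub_neq0 z a : 0 <= ImC z -> ImC a < 0 -> z - a != 0.
Proof.
move=> z0 a0; rewrite subr_eq0; apply/eqP => za.
by have := lt_le_trans a0 z0; rewrite za ltxx.
Qed.

Lemma derivable_partial_fraction s z : lower_poles s -> 0 <= ImC z ->
  derivable (partial_fraction s : C^o -> C^o) z 1.
Proof.
move=> + z0; elim: s => [|p s IHs] sl.
  rewrite (_ : partial_fraction [::] = cst 0); first exact: derivable_cst.
  by apply/funext => w; rewrite /partial_fraction big_nil.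
have [p0 sl'] := lower_poles_cons sl.
rewrite (_ : partial_fraction (p :: s) =
  (fun w => p.1 * (w - p.2)^-1 + partial_fraction s w)); last first.
  by apply/funext => w; rewrite /partial_fraction big_cons.
apply: (@derivableD C C^o); last exact: IHs.
apply: (@derivableM C C^o); first exact: derivable_cst.
apply: (@derivableV C C^o); first exact: Im_ge0_sub_neq0.
by apply: (@derivableB C C^o); [exact: derivable_id|exact: derivable_cst].
Qed.

Lemma partial_fraction_bounded s : lower_poles s ->
  exists M : R, forall z, 0 < ImC z -> normc (partial_fraction s z) <= M.
Proof.
elim: s => [|p s IHs] sl.
  by exists 0 => z _; rewrite /partial_fraction big_nil ComplexField.Normc.normc0.
have [p0 sl'] := lower_poles_cons sl; have [M sM] := IHs sl'.
exists (normc p.1 * (- ImC p.2)^-1 + M) => z z0.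
rewrite /partial_fraction big_cons (le_trans (le_normcD _ _)) // lerD ?sM //.
rewrite ComplexField.Normc.normcM ComplexField.Normc.normcV.
rewrite ler_wpM2l ?sqrtr_ge0 //; first by case: (p.1) => ? ?; exact: sqrtr_ge0.
have n0 : 0 < - ImC p.2 by rewrite oppr_gt0.
have nn : - ImC p.2 <= normc (z - p.2).
  rewrite -lecR; apply: le_trans (Im_le_norm (z - p.2)); rewrite lecR.
  by rewrite raddfB /= (le_trans _ (ler_norm _)) // lerDr ltW.
by rewrite lef_pV2 ?posrE // (lt_le_trans n0).
Qed.

Definition half_plane_fun (W : C -> C) s z : C :=
  if 0 < ImC z then W z * partial_fraction s z else 0.

Lemma partial_fraction_boundary (f : C -> C) s (x : R) : lower_poles s ->
  (forall z, 0 < ImC z -> f z = partial_fraction s z) ->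
  (f (x +i* y) : C^o) @[y --> 0^'+] --> (partial_fraction s x%:C : C^o).
Proof.
move=> sl fE.
have yx : (x +i* y : C^o) @[y --> (0 : R)^'+] --> (x%:C : C^o).
  apply: cvg_complex; first exact: cvg_cst.
  by apply: cvg_at_right_filter; exact: cvg_id.
have sc : {for x%:C, continuous (partial_fraction s : C^o -> C^o)}.
  apply: differentiable_continuous; apply/derivable1_diffP.
  by apply: derivable_partial_fraction => //=.
have sx : (partial_fraction s (x +i* y) : C^o) @[y --> (0 : R)^'+] -->
    (partial_fraction s x%:C : C^o).
  by move=> P /sc sP; exact: yx sP.
apply: cvg_trans sx; apply: near_eq_cvg; near=> y.
by rewrite fE //=; near: y; exact: nbhs_right_gt.
Unshelve. all: by end_near. Qed.

Lemma boundary_value_partial_fraction (f : C -> C) s (x : R) : lower_poles s ->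
  (forall z, 0 < ImC z -> f z = partial_fraction s z) ->
  boundary_value f x = partial_fraction s x%:C.
Proof.
move=> sl fE; apply: (@cvg_lim C^o (@norm_hausdorff _ _)).
exact: partial_fraction_boundary.
Qed.

Lemma partial_fractionM s t (x : R) :
  partial_fraction s x%:C * conjc (partial_fraction t x%:C) =
  \sum_(p <- s) \sum_(q <- t)
    p.1 * conjc q.1 * (resolvent p.2 x * resolvent (conjc q.2) x).
Proof.
rewrite /partial_fraction (rmorph_sum Num.conj) /= mulr_suml.
apply: eq_bigr => p _; rewrite mulr_sumr; apply: eq_bigr => q _.
rewrite -resolvent_conj /resolvent (rmorphM (@Num.conj C)) /=.
by rewrite mulrACA.
Qed.

Lemma cintegrable_term s t (p q : C * C) : lower_poles s -> lower_poles t ->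
  p \in s -> q \in t -> cintegrable (fun x =>
    p.1 * conjc q.1 * (resolvent p.2 x * resolvent (conjc q.2) x)).
Proof.
move=> sl tl ps qt; apply/cintegrableZ/cintegrable_resolvent2.
  by rewrite lt_eqF // sl.
by case: q qt => d [a b] /tl /= b0; rewrite oppr_eq0 lt_eqF.
Qed.

Lemma cintegrable_partial_fraction2 s t : lower_poles s -> lower_poles t ->
  cintegrable (fun x : R =>
    partial_fraction s x%:C * conjc (partial_fraction t x%:C)).
Proof.
move=> sl tl; under eq_fun do rewrite partial_fractionM.
by apply: cintegrable_sum => p ps; apply: cintegrable_sum => q qt;
  apply: (cintegrable_term sl tl).
Qed.

Lemma complex_integral_partial_fraction2 s t :
  lower_poles s -> lower_poles t ->
  complex_integral (fun x : R =>
    partial_fraction s x%:C * conjc (partial_fraction t x%:C)) =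
  \sum_(p <- s) \sum_(q <- t)
    p.1 * conjc q.1 * (2 * 'i%C * pi%:C / (conjc q.2 - p.2)).
Proof.
move=> sl tl; under eq_fun do rewrite partial_fractionM.
rewrite complex_integral_sum; last first.
  move=> p ps; apply: cintegrable_sum => q qt; exact: (cintegrable_term sl tl).
apply: eq_big_seq => p ps; rewrite complex_integral_sum; last first.
  by move=> q qt; exact: (cintegrable_term sl tl).
apply: eq_big_seq => q qt.
have p0 := sl _ ps; have q0 : 0 < ImC (conjc q.2).
  by case: q qt => d [a b] /tl /= b0; rewrite oppr_gt0.
rewrite complex_integralZ; last first.
  by apply: cintegrable_resolvent2; [rewrite lt_eqF|rewrite gt_eqF].
congr (_ * _); rewrite complex_integral_resolvent2; first last.
- by apply/eqP => pq; have := lt_trans p0 q0; rewrite pq ltxx.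
- by rewrite gt_eqF.
- by rewrite lt_eqF.
rewrite (ltr0_sg p0) (gtr0_sg q0) -[conjc q.2 - p.2]opprB invrN !mulrN -mulNr.
by congr (_ / _); rewrite rmorphM rmorphB rmorphN rmorph1 /=; ring.
Qed.

Lemma normc_sqr (z : C) : normc z ^+ 2 = ReC (z * conjc z).
Proof.
case: z => a b /=; rewrite sqr_sqrtr ?addr_ge0 ?sqr_ge0 //.
by rewrite !expr2 mulrN opprK.
Qed.

Lemma square_integrable_partial_fraction (f : C -> C) s : lower_poles s ->
  (forall z, 0 < ImC z -> f z = partial_fraction s z) ->
  square_integrable_boundary_values f.
Proof.
move=> sl fE; split.
  apply: aeW => x; apply/cvg_ex; exists (partial_fraction s x%:C).
  exact: partial_fraction_boundary.
have [i1 _] := cintegrable_partial_fraction2 sl sl.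
under eq_fun do rewrite (boundary_value_partial_fraction _ sl fE) normc_sqr.
exact: i1.
Qed.

Lemma partial_fraction_numerator s : exists P : {poly C}, forall z,
  (forall p, p \in s -> z != p.2) ->
  partial_fraction s z * \prod_(p <- s) (z - p.2) = P.[z].
Proof.
elim: s => [|p s [P PE]].
  by exists 0 => z _; rewrite /partial_fraction !big_nil horner0 mul0r.
exists (p.1 *: \prod_(q <- s) ('X - q.2%:P) + ('X - p.2%:P) * P) => z zs.
have zp : z - p.2 != 0 by rewrite subr_eq0 zs // mem_head.
rewrite hornerD hornerZ hornerM hornerXsubC -PE; last first.
  by move=> q qs; apply: zs; rewrite inE qs orbT.
rewrite horner_prod (eq_bigr _ (fun q _ => hornerXsubC q.2 z)).
by rewrite /partial_fraction !big_cons; field.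
Qed.

Lemma normc_ge0 (z : C) : 0 <= normc z.
Proof. by case: z => u v; exact: sqrtr_ge0. Qed.

Lemma normc_gt0 (z : C) : z != 0 -> 0 < normc z.
Proof.
move=> z0; rewrite lt_def normc_ge0 andbT; apply: contra_neq z0.
exact: ComplexField.Normc.eq0_normc.
Qed.

Lemma poles_prod_neq0 s z : lower_poles s -> 0 <= ImC z ->
  \prod_(p <- s) (z - p.2) != 0.
Proof.
move=> sl z0; rewrite prodf_seq_neq0; apply/allP => p ps /=.
by rewrite Im_ge0_sub_neq0 // sl.
Qed.

(** [log |z - a|], expressed through [sqdist] so that [log_poisson] applies on the real axis. *)
Definition log_factor z a : R :=
  ln (sqdist (ReC a) (ImC z - ImC a) (ReC z)) / 2.

Lemma ln_normcB z a : ln (normc (z - a)) = log_factor z a.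
Proof.
rewrite /log_factor (_ : sqdist _ _ _ = normc (z - a) ^+ 2); last first.
  rewrite normc_sqr /sqdist; case: z a => x y [b c] /=; ring.
have [z0|z0] := leP (normc (z - a)) 0; last by rewrite lnXn // -mulr_natr; field.
have -> : normc (z - a) = 0.
  by apply/eqP; rewrite eq_le z0; case: (z - a) => ? ?; rewrite sqrtr_ge0.
by rewrite expr0n /= ln0 // mul0r.
Qed.

Definition log_sum (rs : seq C) z : R := \sum_(a <- rs) log_factor z a.

Lemma ln_normc_prod (rs : seq C) z : \prod_(a <- rs) (z - a) != 0 ->
  ln (normc (\prod_(a <- rs) (z - a))) = log_sum rs z.
Proof.
rewrite /log_sum; elim: rs => [|a rs IHrs].
  by rewrite !big_nil ComplexField.Normc.normc1 ln1.
rewrite !big_cons mulf_eq0 negb_or => /andP[za rs0].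
by rewrite ComplexField.Normc.normcM lnM ?posrE ?normc_gt0 // IHrs // ln_normcB.
Qed.

Lemma measurable_lne_EFin (g : R -> R) : measurable_fun [set: R] g ->
  measurable_fun [set: R] (fun t => lne (g t)%:E).
Proof.
move=> mg; rewrite /lne; apply: measurable_fun_ifT => //.
  exact: measurable_fun_ler.
by apply/measurable_EFinP; apply: measurableT_comp mg; exact: measurable_ln.
Qed.

Lemma measurable_normc_partial_fraction s : lower_poles s ->
  measurable_fun [set: R] (fun t : R => normc (partial_fraction s t%:C)).
Proof.
move=> sl; have [/integrableP[/measurable_EFinP m2 _] _] :=
  cintegrable_partial_fraction2 sl sl.
rewrite (_ : (fun t => _) = (fun t => Num.sqrt (ReC (partial_fraction s t%:C *
    conjc (partial_fraction s t%:C))))); last first.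
  by apply/funext => t; rewrite -normc_sqr sqrtr_sqr ger0_norm // normc_ge0.
apply: measurableT_comp m2.
by apply: continuous_measurable_fun; exact: sqrt_continuous.
Qed.

(** * The logarithmic inequality for partial fractions *)

Section LogBound.
Variables (x y : R).
Hypothesis y0 : 0 < y.
Local Notation q t := ((sqdist x y t)^-1).

(** For real [t], [log |t - a|] does not change when [a] is reflected to [Re a - i |Im a|], and the
    logarithm of the distance to the reflected point is harmonic above the axis. This is the sum of
    these harmonic functions at [x + i y]. *)
Definition log_sum_reflected (rs : seq C) : R :=
  \sum_(a <- rs) ln (sqdist (ReC a) (y + `|ImC a|) x) / 2.

Lemma log_sum_Poisson (rs : seq C) :
  mu.-integrable setT (fun t => (q t * log_sum rs t%:C)%:E) /\
  \int[mu]_t (q t * log_sum rs t%:C) = pi / y * log_sum_reflected rs.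
Proof.
rewrite /log_sum /log_sum_reflected; elim: rs => [|a rs [IH1 IH2]].
  split; first by under eq_fun do rewrite big_nil mulr0; apply: integrable0.
  under eq_Rintegral do rewrite big_nil mulr0.
  by rewrite Rintegral_cst // mul0r big_nil mulr0.
have E t : q t * \sum_(b <- a :: rs) log_factor t%:C b =
   q t * (ln (sqdist (ReC a) `|ImC a| t) / 2) + q t * \sum_(b <- rs) log_factor t%:C b.
  rewrite big_cons mulrDr; congr (_ * (ln _ / 2) + _).
  by rewrite /sqdist /= sub0r sqrrN real_normK ?num_real.
have [i1 I1] := log_poisson x y0 (ReC a) (normr_ge0 (ImC a)).
split; first by under eq_fun do rewrite E; exact: integrableD_real.
under eq_Rintegral do rewrite E.
by rewrite RintegralD // I1 IH2 big_cons mulrDr.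
Qed.

(** Reflecting a zero below the axis can only move it away from [x + i y]; zeros above the axis are
    the source of the inequality. *)
Lemma log_sum_le_reflected (rs : seq C) : \prod_(a <- rs) (x +i* y - a) != 0 ->
  log_sum rs (x +i* y) <= log_sum_reflected rs.
Proof.
rewrite /log_sum /log_sum_reflected; elim: rs => [|a rs IHrs].
  by rewrite !big_nil.
rewrite !big_cons mulf_eq0 negb_or => /andP[za rs0]; rewrite lerD ?IHrs //.
rewrite /log_factor ler_pM2r ?invr_gt0 //=.
have le_im : (y - ImC a) ^+ 2 <= (y + `|ImC a|) ^+ 2.
  have := ler_norm (- ImC a); have := ler_norm (ImC a); rewrite normrN.
  move: (`|ImC a|) => b b1 b2; rewrite -subr_ge0.
  rewrite (_ : _ - _ = (b + ImC a) * (y + y + (b - ImC a))); last by ring.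
  apply: mulr_ge0; first by rewrite -[ImC a]opprK subr_ge0.
  by rewrite addr_ge0 ?subr_ge0 // addr_ge0 // ltW.
have n0 : 0 < sqdist (ReC a) (y - ImC a) x.
  have := exprn_gt0 2 (normc_gt0 za); rewrite normc_sqr.
  by case: (a) => c d; rewrite /sqdist /= mulrN opprK -!expr2.
have n1 : sqdist (ReC a) (y - ImC a) x <= sqdist (ReC a) (y + `|ImC a|) x.
  by rewrite /sqdist lerD2l.
by rewrite ler_ln ?posrE // (lt_le_trans n0).
Qed.

(** Poles enter with a minus sign, so an inequality would point the wrong way; they already lie
    below the axis and reflection fixes them. *)
Lemma log_sum_lower s : lower_poles s ->
  log_sum [seq p.2 | p <- s] (x +i* y) = log_sum_reflected [seq p.2 | p <- s].
Proof.
rewrite /log_sum /log_sum_reflected !big_map => sl; apply: eq_big_seq => p /sl p0.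
by rewrite /log_factor /= ltr0_norm.
Qed.

Lemma log_poisson_partial_fraction (f : C -> C) s : lower_poles s ->
  (forall z, 0 < ImC z -> f z = partial_fraction s z) ->
  (lne (normc (f (x +i* y)))%:E <=
     (y / pi)%:E *
     \int[mu]_t
       (lne (normc (boundary_value f t))%:E * (((t - x) ^+ 2 + y ^+ 2)^-1)%:E))%E.
Proof.
move=> sl fE; rewrite fE //=.
have [P PE] := partial_fraction_numerator s.
have PEz z : 0 <= ImC z ->
    partial_fraction s z * \prod_(p <- s) (z - p.2) = P.[z].
  by move=> z0; apply: PE => p /sl p0; rewrite -subr_eq0; exact: Im_ge0_sub_neq0.
have D0 z : 0 <= ImC z -> _ := poles_prod_neq0 sl.
have [r0|r0] := eqVneq (partial_fraction s (x +i* y)) 0.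
  by rewrite r0 ComplexField.Normc.normc0 /lne lexx leNye.
have [rs Prs] := closed_field_poly_normal P.
pose k := ln (normc (lead_coef P)).
pose ps := [seq p.2 | p <- s].
have Phorner z : P.[z] = lead_coef P * \prod_(a <- rs) (z - a).
  rewrite {1}Prs hornerZ horner_prod; congr (_ * _).
  by apply: eq_bigr => a _; rewrite hornerXsubC.
have y0' : 0 <= ImC (x +i* y) by exact: ltW.
have : P.[x +i* y] != 0 by rewrite -PEz // mulf_neq0 // D0.
rewrite Phorner mulf_eq0 negb_or => /andP[l0 rs0].
pose L z := k + log_sum rs z - log_sum ps z.
have lnL z : 0 <= ImC z -> \prod_(a <- rs) (z - a) != 0 ->
    0 < normc (partial_fraction s z) /\ ln (normc (partial_fraction s z)) = L z.
  move=> z0 rz; have P0 : P.[z] != 0 by rewrite Phorner mulf_neq0.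
  have f0 : partial_fraction s z != 0.
    by apply: contra_neq P0 => f0; rewrite -PEz // f0 mul0r.
  split; first exact: normc_gt0.
  have := congr1 (fun u => ln (normc u)) (PEz z z0).
  rewrite Phorner !ComplexField.Normc.normcM !lnM ?posrE ?normc_gt0 ?D0 //.
  rewrite (ln_normc_prod rz) /L => <-.
  have -> : log_sum ps z = ln (normc (\prod_(p <- s) (z - p.2))).
    by rewrite -(big_map snd xpredT (fun a => z - a)) ln_normc_prod // big_map D0.
  by rewrite addrK.
have yN0 : y != 0 by rewrite gt_eqF.
have [i1 I1] := log_sum_Poisson rs; have [i2 I2] := log_sum_Poisson ps.
have qi : mu.-integrable setT (fun t => (q t)%:E).
  by apply: rational_decay_integrable; exact: rational_decay_sqdistV.
have Iq : \int[mu]_t q t = pi / y.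
  have := Rintegral_sqdistV x y0; rewrite RintegralZl // => <-.
  by rewrite [RHS]mulrC mulrA mulVf ?mul1r.
have EL t : q t * L t%:C = k * q t + q t * log_sum rs t%:C - q t * log_sum ps t%:C.
  by rewrite /L; ring.
have ki := integrableZ_real k qi.
have iL : mu.-integrable setT (fun t => (q t * L t%:C)%:E).
  under eq_fun do rewrite EL -[X in _ + X]mulN1r.
  by apply: integrableD_real; [exact: integrableD_real|exact: integrableZ_real].
have IL : \int[mu]_t (q t * L t%:C) =
    pi / y * (k + log_sum_reflected rs - log_sum_reflected ps).
  under eq_Rintegral do rewrite EL.
  rewrite RintegralB //; last exact: integrableD_real.
  by rewrite RintegralD // RintegralZl // Iq I1 I2; ring.
(* [lne] of the boundary value and [L] can differ only at real zeros of the numerator, where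
   [lne 0 = -oo] but [ln 0 = 0]. The real parts of all roots form a finite, hence null, set
   containing these zeros. *)
have -> : (\int[mu]_t (lne (normc (boundary_value f t))%:E *
    (((t - x) ^+ 2 + y ^+ 2)^-1)%:E) = \int[mu]_t (q t * L t%:C)%:E)%E.
  under eq_integral do rewrite (boundary_value_partial_fraction _ sl fE).
  have /integrableP[mL _] := iL.
  have [/measurable_EFinP mq _] := elimT (integrableP _ _ _) qi.
  apply: ae_eq_integral => //.
    apply: emeasurable_funM; last exact/measurable_EFinP.
    by apply: measurable_lne_EFin; exact: measurable_normc_partial_fraction.
  have cnt : countable [set t | t \in map ReC rs].
    by apply: finite_set_countable; exact: finite_seq.
  exists [set t | t \in map ReC rs]; split.
  - by apply: countable_measurable => //.
  - exact: countable_lebesgue_measure0.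
  move=> t /= /not_implyP[_]; apply: contra_notT => trs.
  have rt : \prod_(a <- rs) (t%:C - a) != 0.
    rewrite prodf_seq_neq0; apply/allP => a ars /=; rewrite subr_eq0.
    by apply: contraNneq trs => ta; rewrite -[t]/(ReC t%:C) ta map_f.
  have [f0 fL] := lnL t%:C (lexx _) rt.
  by rewrite (lt_geF f0) fL -EFinM mulrC.
have [f0 fL] := lnL _ y0' rs0.
rewrite integral_fine // IL -EFinM (lt_geF f0) fL lee_fin.
have -> : y / pi * (pi / y * (k + log_sum_reflected rs - log_sum_reflected ps)) =
   k + log_sum_reflected rs - log_sum_reflected ps.
  by move: (lt0r_neq0 (pi_gt0 R)); move: pi => c c0; field; rewrite yN0 c0.
by rewrite /L log_sum_lower // lerD2r lerD2l log_sum_le_reflected.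
Qed.

End LogBound.
End Rational.

(** * The kernel of an accretive shift *)

Section Final.
Variable R : realType.
Local Notation C := R[i].
Local Notation ReC := (@complex.Re R).
Local Notation ImC := (@complex.Im R).
Implicit Types (s t : seq (C * C)) (z w : C).

Section FixedW.
Variable W : C -> C.
Hypothesis W_holo : holomorphic_on (@upper_half_plane R) W.
Hypothesis W_neq0 : forall z : C, 0 < ImC z -> W z != 0.

Lemma half_plane_fun_div s z : 0 < ImC z ->
  half_plane_fun W s z / W z = partial_fraction s z.
Proof.
by move=> z0; rewrite /half_plane_fun z0 [W z * _]mulrC mulfK // W_neq0.
Qed.

Lemma FW_half_plane_fun s : lower_poles s -> FW W (half_plane_fun W s).
Proof.
move=> sl; have fE := half_plane_fun_div s.
split.
- by move=> z; rewrite /upper_half_plane /half_plane /= /half_plane_fun => /negP/negPf ->.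
- move=> z z0; apply: (@near_eq_derivable C C^o C^o
    (fun z => W z * partial_fraction s z)).
    near=> w; rewrite /half_plane_fun ifT //.
    by apply/upperE; near: w; apply/near_upper/upperE.
  apply: (@derivableM C C^o); first exact: W_holo.
  by apply: derivable_partial_fraction => //; exact: ltW.
- have [M sM] := partial_fraction_bounded sl.
  exists (partial_fraction s), (fun=> 1); split.
  + split; last by exists M.
    by move=> z z0; apply: derivable_partial_fraction => //; exact: ltW.
  + split; first by move=> z _; exact: derivable_cst.
    by exists 1 => z _; rewrite ComplexField.Normc.normc1.
  + by exists 'i%C; rewrite /upper_half_plane /half_plane /= ?ltr01 // oner_neq0.
  + by move=> z z0; rewrite mulr1; exact: fE.
- exact: square_integrable_partial_fraction sl fE.
- by move=> x y y0; exact: (log_poisson_partial_fraction x y0 sl fE).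
Unshelve. all: by end_near. Qed.

Lemma FW_inner_half_plane_fun s t : lower_poles s -> lower_poles t ->
  FW_inner W (half_plane_fun W s) (half_plane_fun W t) =
  \sum_(p <- s) \sum_(q <- t)
    p.1 * conjc q.1 * (2 * 'i%C * pi%:C / (conjc q.2 - p.2)).
Proof.
move=> sl tl; rewrite -complex_integral_partial_fraction2 //; congr complex_integral.
apply/funext => x.
by rewrite !(boundary_value_partial_fraction _ _ (half_plane_fun_div _)).
Qed.

(** As a function of [z], [FW_kernel W w z / W z] has one pole [conjc w], in the lower half-plane,
    with residue [- conjc (W w) / (2 pi i)]. *)
Definition kernel_poles s : seq (C * C) :=
  [seq (p.1 * (- conjc (W p.2) / (2 * pi%:C * 'i%C)), conjc p.2) | p <- s].

Definition upper_points s := forall p, p \in s -> 0 < ImC p.2.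

Lemma lower_kernel_poles s : upper_points s -> lower_poles (kernel_poles s).
Proof.
move=> su p /mapP[q qs ->] /=; have := su q qs.
by case: (q.2) => a b /=; rewrite oppr_lt0.
Qed.

Definition kernel_sum s z : C := \sum_(p <- s) p.1 * FW_kernel W p.2 z.

Lemma kernel_sumE s : kernel_sum s = half_plane_fun W (kernel_poles s).
Proof.
apply/funext => z; rewrite /kernel_sum /half_plane_fun /FW_kernel.
case: ifP => z0; last by rewrite big1 // => p _; rewrite mulr0.
rewrite /partial_fraction mulr_sumr big_map; apply: eq_bigr => p _ /=.
rewrite -[z - conjc p.2]opprB !invfM invrN; ring.
Qed.

Lemma FW_kernel_sum s : upper_points s -> FW W (kernel_sum s).
Proof.
by move=> su; rewrite kernel_sumE; apply/FW_half_plane_fun/lower_kernel_poles.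
Qed.

Lemma FW_FW_kernel w : 0 < ImC w -> FW W (FW_kernel W w).
Proof.
move=> w0; rewrite (_ : FW_kernel W w = kernel_sum [:: (1, w)]).
  by apply: FW_kernel_sum => p; rewrite inE => /eqP ->.
by apply/funext => z; rewrite /kernel_sum big_seq1 mul1r.
Qed.

Variable T : (C -> C) -> (C -> C).
Hypothesis T_lin : FW_linear_transformation W T.
Hypothesis T_kernel : forall w : C, 0 < ImC w ->
  T (FW_kernel W w) = FW_kernel W (w + 'i%C).
Hypothesis T_accr : forall F : C -> C, FW W F -> 0 <= ReC (FW_inner W F (T F)).

Definition shift_points s : seq (C * C) := [seq (p.1, p.2 + 'i%C) | p <- s].

Lemma T_kernel_sum s : upper_points s ->
  T (kernel_sum s) = kernel_sum (shift_points s).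
Proof.
have [_ Tl] := T_lin; elim: s => [|p s IHs] su.
  have F0 : FW W (kernel_sum [::]) by exact: FW_kernel_sum.
  (* Linearity is available for combinations [a F + b G] only; [a = b = 0] yields [T 0 = 0]. *)
  have := Tl 0 0 _ _ F0 F0.
  rewrite (_ : (fun z => 0 * _ + _) = kernel_sum [::]); last first.
    by apply/funext => z; rewrite !mul0r addr0 /kernel_sum big_nil.
  by move=> ->; apply/funext => z; rewrite !mul0r addr0 /kernel_sum big_nil.
have p0 : 0 < ImC p.2 by apply: su; rewrite mem_head.
have su' : upper_points s by move=> q qs; apply: su; rewrite inE qs orbT.
have := Tl p.1 1 _ _ (FW_FW_kernel p0) (FW_kernel_sum su').
rewrite IHs // T_kernel // (_ : (fun z => p.1 * FW_kernel W p.2 z + _) = kernel_sum (p :: s)).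
  by move=> ->; apply/funext => z; rewrite /kernel_sum big_cons mul1r.
by apply/funext => z; rewrite /kernel_sum big_cons mul1r.
Qed.

(** [2 pi] times the sum of [K(w, z + i)] and its hermitian adjoint [conj K(z, w + i)]. *)
Definition accretive_kernel z w : C :=
  (W (z + 'i%C) * conjc (W w) + W z * conjc (W (w + 'i%C))) * ('i%C / (z + 'i%C - conjc w)).

Let half_kernel z w : C := W (z + 'i%C) * conjc (W w) * ('i%C / (z + 'i%C - conjc w)).

Lemma conj_coef (c w : C) :
  conjc (conjc c * (- conjc w / (2 * pi%:C * 'i%C))) = c * (w / (2 * pi%:C * 'i%C)).
Proof.
have := @conj_mul_div C c w (2 * pi%:C * 'i%C); apply.
by apply/eqP; rewrite eq_complex /=; apply/andP; split; apply/eqP; ring.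
Qed.

Lemma accretive_kernel_psd : psd (fun z => 0 < ImC z) accretive_kernel.
Proof.
move=> s su.
(* [FW_inner] is conjugate-linear in [T F], whose points become the first argument of [half_kernel],
   the one that [kernel_form] weights without conjugation; conjugating the coefficients reconciles
   the two. *)
pose s' := [seq (conjc p.1, p.2) | p <- s].
have su' : upper_points s' by move=> p /mapP[q /su ? ->].
have su'' : upper_points (shift_points s').
  move=> p /mapP[q /su' q0 ->] /=; rewrite raddfD /=.
  by rewrite addr_gt0.
have := T_accr (FW_kernel_sum su'); rewrite T_kernel_sum // !kernel_sumE.
rewrite FW_inner_half_plane_fun; try exact: lower_kernel_poles.
set X := \sum_(p <- _) _ => X0.
have piN0 : (pi : R)%:C != 0 by rewrite (inj_eq (@complexI R)) lt0r_neq0 // pi_gt0.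
have XE : kernel_form half_kernel s = 2 * pi%:C * X.
  rewrite /X !big_map mulr_sumr /kernel_form exchange_big /=.
  apply: eq_bigr => p _; rewrite !big_map mulr_sumr; apply: eq_bigr => q _ /=.
  rewrite conj_coef conjcK /half_kernel -[Num.conj p.1]/(conjc p.1).
  move: (pi%:C) piN0 => c c0; have i0 : 'i%C != 0 :> C by rewrite complexiE neq0Ci.
  rewrite -[q.2 + 'i%C - conjc p.2]invrK; move: (q.2 + 'i%C - conjc p.2)^-1 => v.
  rewrite !invrK; move: (W (q.2 + 'i%C)) => b.
  have iV : 'i%C = - 'i%C^-1 :> C.
    by apply: (mulfI i0); rewrite mulrN divff // -expr2 sqr_i.
  by rewrite {1}iV; field; rewrite c0 i0.
(* The form is twice the real part of that of [half_kernel], the quantity controlled by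
   accretivity. *)
have -> : kernel_form accretive_kernel s =
    kernel_form half_kernel s + Num.conj (kernel_form half_kernel s).
  rewrite kernel_form_conj -kernel_formD; apply: eq_kernel_form => p q _ _.
  rewrite /accretive_kernel /half_kernel mulrDl; congr (_ + _).
  have iC : Num.conj ('i%C : C) = - 'i%C.
    by apply/eqP; rewrite eq_complex /= oppr0 !eqxx.
  by rewrite -(conj_half_kernel (W (q.2 + 'i%C)) (W p.2) q.2 p.2 iC).
rewrite addcJ mulr_ge0 // lecR XE complex_ReM [X in _ - X * _](_ : _ = 0).
  rewrite mul0r subr0 mulr_ge0 // complex_ReM /= mulr0 subr0.
  by rewrite mulr_ge0 ?pi_ge0 //= addr0.
by rewrite complex_ImM /= mulr0 add0r addr0 mul0r.
Qed.

Let h : C := 0 +i* 2^-1.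

Let hD : h + h = 'i%C.
Proof. by apply/eqP; rewrite eq_complex /= addr0 -[2^-1]div1r -splitr !eqxx. Qed.

Let conj_h : Num.conj h = - h.
Proof. by apply/eqP; rewrite eq_complex /= oppr0 !eqxx. Qed.

(** If [W (z + i) = - W z], the diagonal entry would be [- 2 |W z|^2 / (2 Im z + 1)], which is
    negative. *)
Lemma WD_neq0 z : 0 < ImC z -> W z + W (z + 'i%C) != 0.
Proof.
move=> z0; have := psd_diag accretive_kernel_psd z0.
rewrite /accretive_kernel; have -> : 'i%C / (z + 'i%C - conjc z) =
    ((2 * ImC z + 1)^-1)%:C :> C.
  have i0 : 'i%C != 0 :> C by rewrite complexiE neq0Ci.
  have -> : z + 'i%C - conjc z = 'i%C * (2 * ImC z + 1)%:C.
    by rewrite addrAC subcJ rmorphD rmorphM rmorph1 rmorph_nat; ring.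
  by rewrite invfM mulrA divff // mul1r fmorphV.
have c0 : 0 < (2 * ImC z + 1)^-1 by rewrite invr_gt0 addr_gt0 // mulr_gt0.
rewrite pmulr_lge0 ?ltcR // => ab0; apply/eqP => ab.
have Wi : W (z + 'i%C) = - W z by apply/eqP; rewrite -addr_eq0 addrC ab.
move: ab0; rewrite Wi raddfN /= mulNr mulrN -opprD -mulr2n -sqr_normc.
rewrite oppr_ge0 pmulrn_lle0 // => W0.
have W1 : 0 < `|W z| ^+ 2 by rewrite exprn_gt0 // normr_gt0 W_neq0.
by move: (lt_le_trans W1 W0); rewrite ltxx.
Qed.

(** [(phi - 1) / (phi + 1)] at [x - i/2], with the denominator [W (x - h + i)] of [phi] cleared. *)
Let f (x : C) : C :=
  (W (x - h) - W (x - h + 'i%C)) / (W (x - h) + W (x - h + 'i%C)).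

Let A (x : C) : Prop := 2^-1 < ImC x.

Let A_sub x : A x -> 0 < ImC (x - h).
Proof. by rewrite /A raddfB /= subr_gt0. Qed.

Lemma schur_transform_psd : psd A (schur_kernel f).
Proof.
pose e x := (W (x - h) + W (x - h + 'i%C))^-1.
have := psd_congruence e (psdZ (ler0n C 2)
  (psd_comp (g := fun x => x - h) A_sub accretive_kernel_psd)).
apply: eq_psd => x y /A_sub x0 /A_sub y0.
have xE : x - h + 'i%C - conjc (y - h) = x - Num.conj y.
  rewrite -[conjc (y - h)]/(Num.conj (y - h)) (conjB_imag _ conj_h) -hD; ring.
rewrite /accretive_kernel xE /schur_kernel -complexiE.
exact: (schur_cayley _ (WD_neq0 x0) (WD_neq0 y0)).
Qed.

Theorem accretive_extension : exists V : C -> C,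
  [/\ forall z : C, 0 < ImC z -> V z = W z,
      holomorphic_on (half_plane (- 2^-1)) V
    & forall z : C, - 2^-1 < ImC z -> 0 <= ReC (V z / V (z + 'i%C))].
Proof.
have AU x : A x -> upper x.
  by move=> Ax; apply/upperE; apply: lt_trans Ax; rewrite invr_gt0.
have [F FU Ff] := schur_extension AU schur_transform_psd.
have Fhol := schur_holomorphic FU.
have hU z : - 2^-1 < ImC z -> upper (z + h).
  by move=> z0; apply/upperE; rewrite raddfD /= -[2^-1]opprK subr_gt0.
have iU z : - 2^-1 < ImC z -> 0 < ImC (z + 'i%C).
  move=> z0; rewrite raddfD /= (lt_trans _ (_ : - 2^-1 + 1 < _)) ?ltrD2r //.
  by rewrite addrC subr_gt0 invf_lt1 // ltr1n.
(* A value 1 would make [F] constant; at the point [i] of [A], where [F = f], this reads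
   [W (i - h + i) = 0]. *)
have F1 x : upper x -> 1 - F x != 0.
  move=> xU; rewrite subr_eq0 eq_sym; apply/eqP => Fx1.
  have Fx : `|F x| = 1 by rewrite Fx1 normr1.
  have iA : A 'i%C by rewrite /A /= invf_lt1 // ltr1n.
  have := schur_maximum (fun _ => id) FU xU Fx (AU _ iA).
  rewrite Ff // Fx1 /f => /(congr1 (fun u => u * (W ('i%C - h) + W ('i%C - h + 'i%C)))).
  rewrite divfK ?WD_neq0 ?A_sub // mul1r => /eqP.
  rewrite -subr_eq0 opprD addrACA subrr add0r -opprD oppr_eq0 -mulr2n mulrn_eq0 /=.
  apply/negP; apply: W_neq0; rewrite raddfD; apply: addr_gt0; last exact: ltr01.
  exact: A_sub.
(* The second factor is the inverse Cayley transform and extends [phi]. As [z + i] already lies in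
   the upper half-plane when [Im z > -1/2], both factors make sense there, and [V z / V (z + i)] is
   the second factor. *)
pose V z := W (z + 'i%C) * ((1 + F (z + h)) / (1 - F (z + h))).
have VW z : 0 < ImC z -> V z = W z.
  move=> z0; have zA : A (z + h) by rewrite /A raddfD /= ltrDr.
  rewrite /V Ff // /f addrK; have s0 := WD_neq0 z0.
  have zi0 : W (z + 'i%C) != 0 by rewrite W_neq0 // raddfD /= addr_gt0.
  field; rewrite s0 /= [X in X != 0](_ : _ = W (z + 'i%C) *+ 2); last by ring.
  by rewrite mulrn_eq0.
exists V; split=> // [z z0|z z0]; last first.
  rewrite (VW (z + 'i%C)) ?iU // /V mulrAC divff ?W_neq0 ?iU // mul1r.
  have := schur_le1 (fun _ => id) FU (hU _ z0); move: (F1 _ (hU _ z0)).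
  move: (F (z + h)) => u u1 uu.
  have := cayley_addJ_ge0 u1 uu.
  by rewrite [X in 0 <= X]addcJ pmulr_rge0 ?ltr0n // lecR.
have shift_d (g : C -> C) (c : C) : derivable (g : C^o -> C^o) (z + c) 1 ->
    derivable ((fun w => g (w + c)) : C^o -> C^o) z 1.
  rewrite /derivable /=; under eq_fun do rewrite addrA. by [].
apply: (@derivableM C C^o).
  by apply: shift_d; apply: W_holo; exact: iU.
have Fd : derivable ((fun w => F (w + h)) : C^o -> C^o) z 1.
  by apply: shift_d; apply: Fhol; apply/upperE; exact: hU.
apply: (@derivableM C C^o).
  by apply: (@derivableD C C^o); [exact: derivable_cst|].
apply: (@derivableV C C^o); first by apply: F1; exact: hU.
by apply: (@derivableB C C^o); [exact: derivable_cst|].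
Qed.

End FixedW.
End Final.

Theorem theorem2 (R : realType) (W : R[i] -> R[i])
    (T : (R[i] -> R[i]) -> (R[i] -> R[i]))
    (W_holo : holomorphic_on (@upper_half_plane R) W)
    (W_neq0 : forall z : R[i], 0 < complex.Im z -> W z != 0)
    (T_lin : FW_linear_transformation W T)
    (T_kernel : forall w : R[i], 0 < complex.Im w ->
       T (FW_kernel W w) = FW_kernel W (w + 'i%C))
    (T_accr : forall F : R[i] -> R[i], FW W F ->
       0 <= complex.Re (FW_inner W F (T F))) :
  exists V : R[i] -> R[i],
    [/\ forall z : R[i], 0 < complex.Im z -> V z = W z,
        holomorphic_on (half_plane (- 2^-1)) V
      & forall z : R[i], - 2^-1 < complex.Im z ->
          0 <= complex.Re (V z / V (z + 'i%C))].
Proof. exact: (accretive_extension W_holo W_neq0 T_lin T_kernel T_accr). Qed.
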